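(* Let $\mathcal{A}\in\mathbb{C}^{I_1\times I_1\times\cdots\times I_N\times I_N}$ and let $\mathcal{B},\mathcal{C}$ be even-order paired tensors of compatible sizes such that $(\mathcal{A},\mathcal{B})$ is stabilizable and $(\mathcal{C},\mathcal{A})$ is detectable. Let $\mathcal{G}=\mathcal{B}*\mathcal{B}^{\mathrm H}$, $\mathcal{K}=\mathcal{C}^{\mathrm H}*\mathcal{C}$, and let $\mathcal{E}$ be the unique positive semidefinite solution of the algebraic Riccati tensor equation $\mathcal{A}^{\mathrm H}*\mathcal{E}+\mathcal{E}*\mathcal{A}-\mathcal{E}*\mathcal{G}*\mathcal{E}+\mathcal{K}=\mathcal{O}$. Let $$\mathcal{Z}=\mathcal{I}_{\mathbf{I}}\otimes(\mathcal{A}-\mathcal{G}*\mathcal{E})^{\mathrm H}+(\mathcal{A}-\mathcal{G}*\mathcal{E})^{\top}\otimes\mathcal{I}_{\mathbf{I}},$$ $$\mathcal{S}_1=\begin{bmatrix}\alpha\|\mathcal{A}\|_F(\mathcal{E}^{\top}\otimes\mathcal{I}_{\mathbf{I}})&\beta\|\mathcal{A}\|_F(\mathcal{I}_{\mathbf{I}}\otimes\mathcal{E})&\|\mathcal{G}\|_F\,\mathcal{E}^{\top}\otimes\mathcal{E}&\|\mathcal{K}\|_F\,\mathcal{I}_{\mathbf{I}\odot\mathbf{I}}\end{bmatrix},$$ $$\mathcal{S}_2=\begin{bmatrix}\alpha(\mathcal{E}^{\top}\otimes\mathcal{I}_{\mathbf{I}})&\beta(\mathcal{I}_{\mathbf{I}}\otimes\mathcal{E})&\mathcal{E}^{\top}\otimes\mathcal{E}&\mathcal{I}_{\mathbf{I}\odot\mathbf{I}}\end{bmatrix}$$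 with $\frac1{\alpha^2}+\frac1{\beta^2}=1$, and $$\eta_c=\left(\|\mathcal{Z}^{-1}*(\mathcal{I}_{\mathbf{I}}\otimes\mathcal{E})\|_2+\|\mathcal{Z}^{-1}*(\mathcal{E}^{\top}\otimes\mathcal{I}_{\mathbf{I}})\|_2\right)\|\mathcal{A}\|_F+\|\mathcal{Z}^{-1}*(\mathcal{E}^{\top}\otimes\mathcal{E})\|_2\|\mathcal{G}\|_F+\|\mathcal{Z}^{-1}\|_2\|\mathcal{K}\|_F.$$ Then the normwise condition numbers $\kappa_1,\kappa_2,\kappa_3$ of the Riccati equation satisfy $$\kappa_1\lesssim\frac{\|\mathcal{Z}^{-1}*\mathcal{S}_1\|_2}{\|\mathcal{E}\|_F},\qquad\kappa_2\lesssim\min\left\{\sqrt3\,\kappa_1,\ \frac{\eta_c}{\|\mathcal{E}\|_F}\right\},\qquad\kappa_3\lesssim\frac{\|\mathcal{Z}^{-1}*\mathcal{S}_2\|_2\sqrt{\|\mathcal{A}\|_F^2+\|\mathcal{G}\|_F^2+\|\mathcal{K}\|_F^2}}{\|\mathcal{E}\|_F},$$ where $\lesssim$ means that ''$\le$'' holds up to the first order in $\|\Delta\mathcal{E}\|_F$, $\Delta\mathcal{E}$ being the perturbation of the solution.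
   Context: Even-order paired tensors are $2N$th-order tensors $\mathcal{A}\in\mathbb{C}^{I_1\times J_1\times\cdots\times I_N\times J_N}$ with entries $\mathcal{A}_{i_1j_1\cdots i_Nj_N}$. Einstein product: $(\mathcal{A}*\mathcal{B})_{i_1k_1\cdots i_Nk_N}=\sum_{j_1,\dots,j_N}\mathcal{A}_{i_1j_1\cdots i_Nj_N}\mathcal{B}_{j_1k_1\cdots j_Nk_N}$; an $N$th-order tensor is regarded as a paired tensor with all column dimensions 1. $(\mathcal{A}^{\top})_{j_1i_1\cdots j_Ni_N}=\mathcal{A}_{i_1j_1\cdots i_Nj_N}$, $\mathcal{A}^{\mathrm H}=\overline{\mathcal{A}^{\top}}$. $\mathcal{O}$ is the zero tensor, $\mathcal{I}_{\mathbf{I}}$ is the identity tensor of size $I_1\times I_1\times\cdots\times I_N\times I_N$ and $\mathcal{I}_{\mathbf{I}\odot\mathbf{I}}$ that of size $I_1^2\times I_1^2\times\cdots\times I_N^2\times I_N^2$; inverses are with respect to $*$. Positive semidefinite: Hermitian and $\mathcal{Y}^{\mathrm H}*\mathcal{E}*\mathcal{Y}\ge0$ for all $N$th-order $\mathcal{Y}$. U-eigenvalue: $\lambda\in\mathbb{C}$ with $\mathcal{A}*\mathcal{X}=\lambda\mathcal{X}$ for some $\mathcal{X}\ne\mathcal{O}$ of order $N$; stable: all U-eigenvalues in the open left-half plane. $\|\cdot\|_F$ is the Frobenius norm; $\|\mathcal{A}\|_2=\sqrt{\lambda_{\max}(\mathcal{A}^{\mathrm H}*\mathcal{A})}$ is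 the spectral norm ($\lambda_{\max}$ = largest U-eigenvalue). $(\mathcal{A},\mathcal{B})$ is stabilizable if $\mathrm{Re}(\lambda)\ge0$, $\mathcal{Y}^{\mathrm H}*\mathcal{A}=\lambda\mathcal{Y}^{\mathrm H}$ and $\mathcal{Y}^{\mathrm H}*\mathcal{B}=\mathcal{O}$ imply $\mathcal{Y}=\mathcal{O}$; $(\mathcal{C},\mathcal{A})$ is detectable if $\mathrm{Re}(\lambda)\ge0$, $\mathcal{A}*\mathcal{Y}=\lambda\mathcal{Y}$ and $\mathcal{C}*\mathcal{Y}=\mathcal{O}$ imply $\mathcal{Y}=\mathcal{O}$. Under these hypotheses there is a unique positive semidefinite solution $\mathcal{E}$ of the Riccati equation such that $\mathcal{A}-\mathcal{G}*\mathcal{E}$ is stable, and then $\mathcal{Z}$ is invertible. Tensor Kronecker product: for tensors $\mathcal{A}\in\mathbb{C}^{K_1\times\cdots\times K_M}$, $\mathcal{B}\in\mathbb{C}^{L_1\times\cdots\times L_M}$ of the same order, $\mathcal{A}\otimes\mathcal{B}$ has entry $\mathcal{A}_{k_1\cdots k_M}\mathcal{B}_{l_1\cdots l_M}$ at the position whose $m$-th index is $(k_m-1)L_m+l_m$. Row block tensors $[\mathcal{X}_1\ \cdots\ \mathcal{X}_p]$ of paired tensors of equal size $I_1\times J_1\times\cdots\times I_N\times J_N$ are concatenations along the first column mode, of size $I_1\times pJ_1\times I_2\times J_2\times\cdots\times I_N\times J_N$, the entry with $j_1=(q-1)J_1+j$ being $(\mathcal{X}_q)_{i_1j\,i_2j_2\cdots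 i_Nj_N}$. Condition numbers: for perturbations $\Delta\mathcal{A},\Delta\mathcal{G},\Delta\mathcal{K}$ of $\mathcal{A},\mathcal{G},\mathcal{K}$, let $\Delta\mathcal{E}=\tilde{\mathcal{E}}-\mathcal{E}$ be the difference between the positive semidefinite solution $\tilde{\mathcal{E}}$ of the perturbed equation $(\mathcal{A}+\Delta\mathcal{A})^{\mathrm H}*\tilde{\mathcal{E}}+\tilde{\mathcal{E}}*(\mathcal{A}+\Delta\mathcal{A})-\tilde{\mathcal{E}}*(\mathcal{G}+\Delta\mathcal{G})*\tilde{\mathcal{E}}+\mathcal{K}+\Delta\mathcal{K}=\mathcal{O}$ and the positive semidefinite solution $\mathcal{E}$ of the original equation. Define $$\kappa_i=\lim_{\epsilon\to0}\ \sup_{\Delta_i\le\epsilon}\frac{\|\Delta\mathcal{E}\|_F}{\epsilon\|\mathcal{E}\|_F}\quad(i=1,2,3),$$ where $\Delta_1=\left\|\begin{bmatrix}\frac{\|\Delta\mathcal{A}\|_F}{\|\mathcal{A}\|_F}&\frac{\|\Delta\mathcal{G}\|_F}{\|\mathcal{G}\|_F}&\frac{\|\Delta\mathcal{K}\|_F}{\|\mathcal{K}\|_F}\end{bmatrix}\right\|_F$, $\Delta_2=\max\left\{\frac{\|\Delta\mathcal{A}\|_F}{\|\mathcal{A}\|_F},\frac{\|\Delta\mathcal{G}\|_F}{\|\mathcal{G}\|_F},\frac{\|\Delta\mathcal{K}\|_F}{\|\mathcal{K}\|_F}\right\}$, and $\Delta_3=\frac{\|[\Delta\mathcal{A}\ \Delta\mathcal{G}\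 \Delta\mathcal{K}]\|_F}{\|[\mathcal{A}\ \mathcal{G}\ \mathcal{K}]\|_F}$.
   Formalization: The perturbed positive semidefinite solution is taken to be the stabilizing one, since it is otherwise not unique and others may blow up; E is assumed nonzero, and for κ₁, κ₂ also A and G, so that the quotients make sense. *)

(* Defs.v *)
From HB Require Import structures.
From mathcomp Require Import all_boot all_order all_algebra.
From mathcomp Require Import all_classical all_reals all_analysis.
From mathcomp Require Import complex.

Set Implicit Arguments.
Unset Strict Implicit.
Unset Printing Implicit Defensive.

Import Order.TTheory GRing.Theory Num.Theory.
Import numFieldNormedType.Exports.

Local Open Scope classical_set_scope.
Local Open Scope complex_scope.
Local Open Scope ring_scope.

(* All indices are 0-based. Tensors have N.+1 pairs of modes, so that there
   is always a first mode, ord0 : 'I_N.+1. *)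

Definition dims (N : nat) := 'I_N.+1 -> nat.

Definition midx (N : nat) (I : dims N) := {dffun forall n : 'I_N.+1, 'I_(I n)}.

(* Paired tensors of size I_1 x J_1 x ... x I_N x J_N; the entry
   A_{i_1 j_1 ... i_N j_N} is A (i, j). *)
Definition ptensor (R : realType) (N : nat) (I J : dims N) :=
  {ffun midx I * midx J -> R[i]}.

Definition ones (N : nat) : dims N := fun=> 1%N.
Arguments ones N : clear implicits.

(* N-th order tensors, i.e. paired tensors whose column dimensions are 1. *)
Definition vtensor (R : realType) (N : nat) (I : dims N) :=
  ptensor R I (ones N).

Section Tensor.
Variables (R : realType) (N : nat).
Implicit Types I J K L : dims N.

Definition einstein I J K (A : ptensor R I J) (B : ptensor R J K) :
    ptensor R I K :=
  [ffun p => \sum_(j : midx J) A (p.1, j) * B (j, p.2)].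

Definition ttr I J (A : ptensor R I J) : ptensor R J I :=
  [ffun p => A (p.2, p.1)].

Definition tadj I J (A : ptensor R I J) : ptensor R J I :=
  [ffun p => (ttr A p)^*%C].

(* R[i] is canonically an R-module, hence *: on ptensor only scales by reals. *)
Definition tscale I J (c : R[i]) (A : ptensor R I J) : ptensor R I J :=
  [ffun p => c * A p].

Definition tid I : ptensor R I I := [ffun p => (p.1 == p.2)%:R].

(* The inverse with respect to the Einstein product (0 if there is none). *)
Definition tinv I (A : ptensor R I I) : ptensor R I I :=
  xget 0 [set B | einstein A B = tid I /\ einstein B A = tid I].

Definition hermitian I (A : ptensor R I I) := tadj A = A.

Definition psd I (A : ptensor R I I) :=
  hermitian A /\
  forall (Y : vtensor R I) (p : midx (ones N) * midx (ones N)),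
    0 <= einstein (einstein (tadj Y) A) Y p.

Definition Ueigenvalue I (A : ptensor R I I) (lambda : R[i]) :=
  exists2 X : vtensor R I, X != 0 & einstein A X = tscale lambda X.

Definition stable I (A : ptensor R I I) :=
  forall lambda : R[i], Ueigenvalue A lambda -> complex.Re lambda < 0.

Definition fro I J (A : ptensor R I J) : R :=
  Num.sqrt (\sum_(p : midx I * midx J) Normc.normc (A p) ^+ 2).

(* Only used for tensors of the form A^H * A, which have finitely many
   U-eigenvalues, all of them real; the supremum is then a maximum. *)
Definition lambda_max I (A : ptensor R I I) : R :=
  sup [set x : R | Ueigenvalue A x%:C].

Definition spectral_norm I J (A : ptensor R I J) : R :=
  Num.sqrt (lambda_max (einstein (tadj A) A)).

Definition stabilizable I J (A : ptensor R I I) (B : ptensor R I J) :=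
  forall (lambda : R[i]) (Y : vtensor R I),
    0 <= complex.Re lambda ->
    einstein (tadj Y) A = tscale lambda (tadj Y) ->
    einstein (tadj Y) B = 0 -> Y = 0.

Definition detectable I L (C : ptensor R L I) (A : ptensor R I I) :=
  forall (lambda : R[i]) (Y : vtensor R I),
    0 <= complex.Re lambda ->
    einstein A Y = tscale lambda Y ->
    einstein C Y = 0 -> Y = 0.

End Tensor.

Notation "A *E B" := (einstein A B) (at level 40, left associativity).
Notation "A ^H" := (tadj A) (at level 1, format "A ^H").
Notation "A ^tr" := (ttr A) (at level 1, format "A ^tr").

(* Kronecker product. The 0-based index p = k * n + l in 'I_(m * n) has
   quotient k and remainder l modulo n. *)

Lemma kron_quo_subproof (m n : nat) (p : 'I_(m * n)) : (p %/ n < m)%N.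
Proof. by case: n p => [|n] p; [case: p => p; rewrite muln0 | rewrite ltn_divLR]. Qed.

Lemma kron_rem_subproof (m n : nat) (p : 'I_(m * n)) : (p %% n < n)%N.
Proof. by case: n p => [|n] p; [case: p => p; rewrite muln0 | rewrite ltn_pmod]. Qed.

Definition dims_mul (N : nat) (I J : dims N) : dims N := fun n => (I n * J n)%N.

Definition midx_quo (N : nat) (I J : dims N) (p : midx (dims_mul I J)) :
    midx I :=
  [ffun n => Ordinal (kron_quo_subproof (p n))].

Definition midx_rem (N : nat) (I J : dims N) (p : midx (dims_mul I J)) :
    midx J :=
  [ffun n => Ordinal (kron_rem_subproof (p n))].

Definition kron (R : realType) (N : nat) (I J K L : dims N)
    (A : ptensor R I J) (B : ptensor R K L) :
    ptensor R (dims_mul I K) (dims_mul J L) :=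
  [ffun p => A (midx_quo p.1, midx_quo p.2) * B (midx_rem p.1, midx_rem p.2)].

Notation "A *K B" := (kron A B) (at level 40, left associativity).

(* Row block tensors, concatenated along the first column mode. The column
   index q = b * J + j of the first mode lies in block b. In the other modes
   q %% J n = q, since q < J n. *)

Definition block_dims (N p : nat) (J : dims N) : dims N :=
  fun n => if n == ord0 then (p * J n)%N else J n.

Lemma block_rem_subproof (N p : nat) (J : dims N) (n : 'I_N.+1)
  (q : 'I_(block_dims p J n)) : (q %% J n < J n)%N.
Proof.
move: q; rewrite /block_dims; case: ifP => _ q; first exact: kron_rem_subproof.
by rewrite ltn_pmod // (leq_ltn_trans _ (ltn_ord q)).
Qed.

Definition block_col (N p : nat) (J : dims N) (q : midx (block_dims p J)) :
    midx J :=
  [ffun n => Ordinal (block_rem_subproof (q n))].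

Definition rowblock (R : realType) (N : nat) (I J : dims N)
    (Xs : seq (ptensor R I J)) : ptensor R I (block_dims (size Xs) J) :=
  [ffun p : midx I * midx (block_dims (size Xs) J) =>
     nth 0 Xs (p.2 ord0 %/ J ord0)%N (p.1, block_col p.2)].

Section Riccati.
Variables (R : realType) (N : nat) (I : dims N).
Local Notation T := (ptensor R I I).
Implicit Types A G K E dA dG dK : T.

Definition riccati A G K E : T := A^H *E E + E *E A - E *E G *E E + K.

(* The perturbed G and K need not be positive semidefinite, in which case a
   Riccati equation may have several positive semidefinite solutions, of which
   some are unbounded as the perturbation tends to 0: with A = -1 and K = 0,
   perturbing G = 0 to -d yields, besides 0, the solution 2 / d. "The" positive
   semidefinite solution is the stabilizing one. *)
Definition stabilizing_solution A G K E :=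
  [/\ psd E, riccati A G K E = 0 & stable (A - G *E E)].

Definition Delta1 A G K dA dG dK : R :=
  Num.sqrt ((fro dA / fro A) ^+ 2 + (fro dG / fro G) ^+ 2
            + (fro dK / fro K) ^+ 2).

Definition Delta2 A G K dA dG dK : R :=
  Num.max (Num.max (fro dA / fro A) (fro dG / fro G)) (fro dK / fro K).

Definition Delta3 A G K dA dG dK : R :=
  fro (rowblock [:: dA; dG; dK]) / fro (rowblock [:: A; G; K]).

(* Delta measures the perturbation (dA, dG, dK) relative to (A, G, K). *)
Definition cond_number (Delta : T -> T -> T -> T -> T -> T -> R) A G K E :
    \bar R :=
  lim (ereal_sup
    [set (fro (p.2 - E) / (eps * fro E))%:E | p in
      [set p : (T * T * T) * T |
        let: (dA, dG, dK, E') := p in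
        Delta A G K dA dG dK <= eps /\
        stabilizing_solution (A + dA) (G + dG) (K + dK) E']]
    @[eps --> (0 : R)^'+]).

Definition S1 (alpha beta : R) A G K E :
    ptensor R (dims_mul I I) (block_dims 4 (dims_mul I I)) :=
  rowblock [:: tscale (alpha * fro A)%:C (E^tr *K tid R I);
               tscale (beta * fro A)%:C (tid R I *K E);
               tscale (fro G)%:C (E^tr *K E);
               tscale (fro K)%:C (tid R (dims_mul I I))].

Definition S2 (alpha beta : R) E :
    ptensor R (dims_mul I I) (block_dims 4 (dims_mul I I)) :=
  rowblock [:: tscale alpha%:C (E^tr *K tid R I);
               tscale beta%:C (tid R I *K E);
               E^tr *K E;
               tid R (dims_mul I I)].

Definition eta_c (Z : ptensor R (dims_mul I I) (dims_mul I I)) A G K E : R :=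
  (spectral_norm (tinv Z *E (tid R I *K E))
   + spectral_norm (tinv Z *E (E^tr *K tid R I))) * fro A
  + spectral_norm (tinv Z *E (E^tr *K E)) * fro G
  + spectral_norm (tinv Z) * fro K.

End Riccati.

(* Main.v *)
Require Import Defs.
From HB Require Import structures.
From mathcomp Require Import all_boot all_order all_algebra.
From mathcomp Require Import all_classical all_reals all_analysis.
From mathcomp Require Import complex.
From mathcomp Require Import ring lra.

Set Implicit Arguments.
Unset Strict Implicit.
Unset Printing Implicit Defensive.

Import Order.TTheory GRing.Theory Num.Theory.
Import numFieldNormedType.Exports.

Local Open Scope complex_scope.
Local Open Scope ring_scope.

(* Write E' = E + H for the stabilizing solution of the perturbed equation and
   Acl = A - G E. Subtracting the two Riccati equations gives
     Acl^H H + H Acl = -(dA^H E + E dA - E dG E + dK) + (terms quadratic in the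
     perturbation and H),
   which in vectorized form reads Z vec(H) = - S w + ..., where w has norm Delta;
   this bounds H to first order, provided that H = O(Delta).

   That a priori bound comes from a second form of the difference,
     P H + H A' = -(dA^H E + E dA - E dG E + dK),
   P = (A + dA)^H - E (G + dG), A' = A + dA - (G + dG) E', where P is close to
   Acl^H whatever E' is, and A' is only known to be stable: a triangularization
   of A' turns it into a triangular system for the columns of H.

   The limit defining a condition number exists because every perturbation can
   be shrunk: for 0 < t <= 1, E + t H is again positive semidefinite, and it
   solves the equation perturbed by about t (dA, dG, dK). The supremum is thus
   nonincreasing in eps up to a factor 1 + O(eps). *)

(** * Euclidean norm of finite families of complex numbers *)

Section L2.
Variable R : realType.
Local Notation normc := (@Normc.normc R).
Implicit Types (T : finType) (x y z : R[i]).

Lemma normc_ge0 x : 0 <= normc x.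
Proof. by case: x => a b /=; exact: sqrtr_ge0. Qed.

Lemma normcE_norm x : (normc x)%:C = `|x|.
Proof. by rewrite normc_def; case: x. Qed.

Lemma normc_conj x : normc x^*%C = normc x.
Proof. by case: x => a b /=; rewrite sqrrN. Qed.

Lemma normc_real (r : R) : normc r%:C = `|r|.
Proof. by rewrite /= expr0n /= addr0 sqrtr_sqr. Qed.

Lemma sqr_normcE x : (normc x ^+ 2)%:C = x^*%C * x.
Proof. by rewrite rmorphXn /= normcE_norm sqr_normc mulrC. Qed.

Lemma le_normc_Re x : `|complex.Re x| <= normc x.
Proof. by rewrite -lecR normcE_norm normc_ge_Re. Qed.

Lemma le_normc_sum T (f : T -> R[i]) :
  normc (\sum_p f p) <= \sum_p normc (f p).
Proof.
elim/big_ind2: _ => // [|x a y b xa yb]; first by rewrite Normc.normc0.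
exact: le_trans (le_normcD _ _) (lerD xa yb).
Qed.

(** Lagrange's identity: the squares [(a p * b q - a q * b p) ^+ 2], summed over all pairs, give
    twice the gap between the two sides. *)
Lemma cauchy_schwarz_sum T (a b : T -> R) :
  (\sum_p a p * b p) ^+ 2 <= (\sum_p a p ^+ 2) * (\sum_p b p ^+ 2).
Proof.
set ab := \sum_p _ * _; set aa := \sum_p a _ ^+ _; set bb := \sum_p b _ ^+ _.
have : 0 <= \sum_p \sum_q (a p * b q - a q * b p) ^+ 2.
  by apply: sumr_ge0 => p _; apply: sumr_ge0 => q _; exact: sqr_ge0.
suff -> : \sum_p \sum_q (a p * b q - a q * b p) ^+ 2 =
    aa * bb + bb * aa - 2 * (ab * ab) by lra.
rewrite /aa /bb /ab !big_distrlr /= mulr_sumr -big_split /= -sumrB.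
apply: eq_bigr => p _; rewrite mulr_sumr -big_split /= -sumrB.
by apply: eq_bigr => q _; ring.
Qed.

(** The index type is arbitrary so that [mfro] and [fro] are both instances up to conversion. *)
Definition l2 T (f : T -> R[i]) : R := Num.sqrt (\sum_p normc (f p) ^+ 2).

Lemma sum_normc_ge0 T (f : T -> R[i]) : 0 <= \sum_p normc (f p) ^+ 2.
Proof. by apply: sumr_ge0 => p _; exact: sqr_ge0. Qed.

Lemma l2_ge0 T (f : T -> R[i]) : 0 <= l2 f.
Proof. exact: sqrtr_ge0. Qed.

Lemma sqr_l2 T (f : T -> R[i]) : l2 f ^+ 2 = \sum_p normc (f p) ^+ 2.
Proof. by rewrite sqr_sqrtr ?sum_normc_ge0. Qed.

Lemma eq_l2 T (f g : T -> R[i]) : f =1 g -> l2 f = l2 g.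
Proof. by move=> fg; congr Num.sqrt; apply: eq_bigr => p _; rewrite fg. Qed.

Lemma l2_eq0 T (f : T -> R[i]) : l2 f = 0 -> forall p, f p = 0.
Proof.
move=> f0 p; have := sqr_l2 f; rewrite f0 expr0n /= => /esym/eqP.
rewrite psumr_eq0 => [/allP /(_ p)|q _]; last exact: sqr_ge0.
by rewrite mem_index_enum => /(_ isT) /=; rewrite sqrf_eq0 => /eqP/Normc.eq0_normc.
Qed.

Lemma l2D T (f g : T -> R[i]) : l2 (fun p => f p + g p) <= l2 f + l2 g.
Proof.
rewrite -(@ler_pXn2r _ 2) ?nnegrE ?addr_ge0 ?l2_ge0 // sqrrD !sqr_l2.
apply: (@le_trans _ _ (\sum_p (normc (f p) + normc (g p)) ^+ 2)).
  by apply: ler_sum => p _; rewrite lerXn2r ?nnegrE ?addr_ge0 ?normc_ge0 ?le_normcD.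
under eq_bigr do rewrite sqrrD.
rewrite !big_split /= lerD2r lerD2l.
rewrite -mulr2n lerMn2r /=.
rewrite -(@ler_pXn2r _ 2) ?nnegrE ?mulr_ge0 ?l2_ge0 //; last first.
  by apply: sumr_ge0 => p _; rewrite mulr_ge0 ?normc_ge0.
by rewrite exprMn !sqr_l2; exact: cauchy_schwarz_sum.
Qed.

Lemma l2Z T c (f : T -> R[i]) : l2 (fun p => c * f p) = normc c * l2 f.
Proof.
rewrite /l2 -[in RHS](ger0_norm (normc_ge0 c)) -sqrtr_sqr -sqrtrM ?sqr_ge0 //.
by rewrite mulr_sumr; congr Num.sqrt; apply: eq_bigr => p _; rewrite Normc.normcM exprMn.
Qed.

Lemma normc_le_l2 T (f : T -> R[i]) p : normc (f p) <= l2 f.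
Proof.
rewrite -(@ler_pXn2r _ 2) ?nnegrE ?l2_ge0 ?normc_ge0 // sqr_l2 (bigD1 p) //=.
by rewrite lerDl; apply: sumr_ge0 => q _; exact: sqr_ge0.
Qed.

Lemma normc_dot_le T (f g : T -> R[i]) :
  normc (\sum_p f p * g p) <= l2 f * l2 g.
Proof.
apply: le_trans (le_normc_sum _) _; under eq_bigr do rewrite Normc.normcM.
rewrite -(@ler_pXn2r _ 2) ?nnegrE ?mulr_ge0 ?l2_ge0 //; last first.
  by apply: sumr_ge0 => p _; rewrite mulr_ge0 ?normc_ge0.
by rewrite exprMn !sqr_l2; exact: cauchy_schwarz_sum.
Qed.

Lemma l2_reindex T (T' : finType) (h : T' -> T) (f : T -> R[i]) :
  bijective h -> l2 f = l2 (f \o h).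
Proof. by move=> bh; congr Num.sqrt; rewrite (reindex h) //; exact: onW_bij. Qed.

Lemma sqr_l2_pair T (T' : finType) (f : T * T' -> R[i]) :
  l2 f ^+ 2 = \sum_p l2 (fun q => f (p, q)) ^+ 2.
Proof.
rewrite sqr_l2 (eq_bigr (fun p => normc (f (p.1, p.2)) ^+ 2)); last by case.
rewrite -(pair_bigA _ (fun p q => normc (f (p, q)) ^+ 2)) /=.
by apply: eq_bigr => p _; rewrite sqr_l2.
Qed.

End L2.

(** * Frobenius norm of complex matrices *)

Section MatrixNorm.
Variable R : realType.
Local Notation C := R[i].
Local Notation normc := (@Normc.normc R).
Local Open Scope sesquilinear_scope.

Definition mfro m n (M : 'M[C]_(m, n)) : R := l2 (fun p => M p.1 p.2).

Lemma mfro_ge0 m n (M : 'M[C]_(m, n)) : 0 <= mfro M.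
Proof. exact: l2_ge0. Qed.

Lemma mfro_eq0 m n (M : 'M[C]_(m, n)) : mfro M = 0 -> M = 0.
Proof. by move=> /l2_eq0 M0; apply/matrixP => i j; rewrite mxE (M0 (i, j)). Qed.

Lemma mfroD m n (M N : 'M[C]_(m, n)) : mfro (M + N) <= mfro M + mfro N.
Proof.
apply: le_trans (l2D _ _); rewrite le_eqVlt; apply/orP; left; apply/eqP.
by apply: eq_l2 => p; rewrite mxE.
Qed.

Lemma mfroZ m n c (M : 'M[C]_(m, n)) : mfro (c *: M) = normc c * mfro M.
Proof. by rewrite /mfro -l2Z; apply: eq_l2 => p; rewrite mxE. Qed.

Lemma mfro0 m n : mfro (0 : 'M[C]_(m, n)) = 0.
Proof. by rewrite -(scale0r 0) mfroZ Normc.normc0 mul0r. Qed.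

Lemma mfroN m n (M : 'M[C]_(m, n)) : mfro (- M) = mfro M.
Proof. by rewrite -scaleN1r mfroZ normcN Normc.normc1 mul1r. Qed.

Lemma mfroB m n (M N : 'M[C]_(m, n)) : mfro (M - N) <= mfro M + mfro N.
Proof. by rewrite -[mfro N]mfroN; exact: mfroD. Qed.

Lemma mfro_sum m n (T : finType) (P : pred T) (M : T -> 'M[C]_(m, n)) :
  mfro (\sum_(t | P t) M t) <= \sum_(t | P t) mfro (M t).
Proof.
elim/big_ind2: _ => // [|x a y b xa yb]; first by rewrite mfro0.
exact: le_trans (mfroD _ _) (lerD xa yb).
Qed.

Lemma normc_le_mfro m n (M : 'M[C]_(m, n)) i j : normc (M i j) <= mfro M.
Proof. exact: (normc_le_l2 (fun p => M p.1 p.2) (i, j)). Qed.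

(** Cauchy-Schwarz for each row of [M] against each column of [N], then summation over both. *)
Lemma mfroM m n p (M : 'M[C]_(m, n)) (N : 'M[C]_(n, p)) :
  mfro (M *m N) <= mfro M * mfro N.
Proof.
rewrite -(@ler_pXn2r _ 2) ?nnegrE ?mulr_ge0 ?mfro_ge0 // exprMn.
rewrite [mfro M ^+ 2]sqr_l2_pair /=.
have -> : mfro N ^+ 2 = \sum_k l2 (fun j => N j k) ^+ 2.
  rewrite [LHS]sqr_l2_pair /=; under eq_bigr do rewrite sqr_l2.
  by rewrite exchange_big /=; under [RHS]eq_bigr do rewrite sqr_l2.
rewrite big_distrlr /= sqr_l2_pair /=; apply: ler_sum => i _.
rewrite sqr_l2; apply: ler_sum => k _; rewrite mxE -exprMn.
rewrite lerXn2r ?nnegrE ?mulr_ge0 ?l2_ge0 ?normc_ge0 //.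
exact: normc_dot_le.
Qed.

Lemma sqr_mfro_col m n (M : 'M[C]_(m, n)) :
  mfro M ^+ 2 = \sum_k mfro (col k M) ^+ 2.
Proof.
rewrite sqr_l2_pair /=; under eq_bigr do rewrite sqr_l2.
rewrite exchange_big /=; apply: eq_bigr => k _; rewrite sqr_l2_pair /=.
by apply: eq_bigr => i _; rewrite sqr_l2 big_ord1 !mxE.
Qed.

(** The trace form turns unitary invariance into matrix algebra. *)
Lemma sqr_mfroE m n (M : 'M[C]_(m, n)) : (mfro M ^+ 2)%:C = \tr (M ^t* *m M).
Proof.
rewrite sqr_mfro_col rmorph_sum /=; apply: eq_bigr => k _.
rewrite sqr_l2_pair rmorph_sum !mxE /=; apply: eq_bigr => i _.
by rewrite sqr_l2 big_ord1 sqr_normcE !mxE.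
Qed.

Lemma mfro_unitaryl m n (U : 'M[C]_m) (M : 'M[C]_(m, n)) :
  U \is unitarymx -> mfro (U *m M) = mfro M.
Proof.
move=> uU; suff : mfro (U *m M) ^+ 2 = mfro M ^+ 2.
  by move/eqP; rewrite eqrXn2 ?mfro_ge0 // => /eqP.
apply: (@complexI R); rewrite !sqr_mfroE trmx_mul map_mxM -mulmxA.
by rewrite [U ^t* *m _]mulmxA -(invmx_unitary uU) mulVmx ?unitarymx_unit ?mul1mx.
Qed.

Lemma mfro_unitaryr m n (U : 'M[C]_n) (M : 'M[C]_(m, n)) :
  U \is unitarymx -> mfro (M *m U) = mfro M.
Proof.
move=> uU; suff : mfro (M *m U) ^+ 2 = mfro M ^+ 2.
  by move/eqP; rewrite eqrXn2 ?mfro_ge0 // => /eqP.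
apply: (@complexI R); rewrite !sqr_mfroE ![\tr (_ ^t* *m _)]mxtrace_mulC.
by rewrite trmx_mul map_mxM mulmxA mulmxtVK.
Qed.

Lemma mfro_delta n (k : 'I_n) : mfro (delta_mx k 0 : 'cV[C]_n) = 1.
Proof.
suff : mfro (delta_mx k 0 : 'cV[C]_n) ^+ 2 = 1 ^+ 2.
  by move/eqP; rewrite eqrXn2 ?mfro_ge0 ?ler01 // => /eqP.
rewrite sqr_l2_pair (bigD1 k) //= big1 => [|i ik].
  by rewrite sqr_l2 big_ord1 mxE !eqxx Normc.normc1 addr0.
by rewrite sqr_l2 big_ord1 mxE (negPf ik) Normc.normc0 expr0n.
Qed.

End MatrixNorm.

(** * Lower bounds for [M - t], uniform over the closed right half-plane *)

Section Resolvent.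
Variable R : realType.
Local Notation C := R[i].
Local Notation normc := (@Normc.normc R).
Local Notation Re := (@complex.Re R).

Definition mstable n (M : 'M[C]_n) := forall (l : C) (x : 'cV[C]_n),
  x != 0 -> M *m x = l *: x -> Re l < 0.

Lemma char_poly_tr n (M : 'M[C]_n) : char_poly M^T = char_poly M.
Proof.
rewrite /char_poly -det_tr; congr (\det _).
by apply/matrixP => i j; rewrite !mxE eq_sym.
Qed.

(** [eigenvalue] speaks of row vectors and [mstable] of columns, whence the passage to the
    transpose. *)
Lemma mstable_root n (M : 'M[C]_n) l :
  mstable M -> root (char_poly M) l -> Re l < 0.
Proof.
move=> sM; rewrite -char_poly_tr -eigenvalue_root_char.
case/eigenvalueP => v vM v0; apply: (sM _ v^T); first by rewrite trmx_eq0.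
by apply: trmx_inj; rewrite trmx_mul trmxK linearZ /= trmxK.
Qed.

(** No compactness is involved: the linear factors of the characteristic polynomial are handled one
    at a time, and each root [l] stays at distance at least [- Re l] from every admissible [t]. *)
Lemma resolvent_bound n (M : 'M[C]_n) : mstable M ->
  exists2 c : R, 0 < c & forall (t : C) p (x : 'M[C]_(n, p)), 0 <= Re t ->
    c * mfro x <= mfro (M *m x - t *: x).
Proof.
case: n M => [|n] M sM.
  by exists 1 => // t p x _; rewrite [x]flatmx0 mfro0 mulr0 mfro_ge0.
have [s Ds] := closed_field_poly_normal (char_poly M).
rewrite (monicP (char_poly_monic _)) scale1r in Ds.
have rs l : l \in s -> Re l < 0.
  by move=> ls; apply: (mstable_root sM); rewrite Ds root_prod_XsubC.
(* The induction on [s] needs a bound for partial products of linear factors. For the full list of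
   roots, Cayley-Hamilton kills the last term. *)
suff [a [b [a0 b0 Hab]]] : exists a b, [/\ 0 <= a, 0 <= b &
    forall (t : C) p (x : 'M[C]_(n.+1, p)), 0 <= Re t ->
    mfro x <= a * mfro (M *m x - t *: x) +
      b * mfro (horner_mx M (\prod_(l <- s) ('X - l%:P)) *m x)].
  exists (a + 1)^-1; first by rewrite invr_gt0; lra.
  move=> t p x t0; rewrite mulrC ler_pdivrMr; last by lra.
  have := Hab t p x t0; rewrite -Ds Cayley_Hamilton mul0mx mfro0 mulr0 addr0.
  move=> H; apply: le_trans H _; rewrite mulrC ler_wpM2l ?mfro_ge0 //; lra.
elim: s rs {Ds} => [|l s IHs] rs.
  exists 0, 1; split => // t p x _.
  by rewrite big_nil rmorph1 mul1mx !mul0r mul1r add0r.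
have [k ks|a [b [a0 b0 Hab]]] := IHs; first by rewrite rs // inE ks orbT.
have l0 : 0 < - Re l by rewrite oppr_gt0 rs ?mem_head.
rewrite big_cons; set q := \prod_(_ <- _) _ in Hab *.
set Q := horner_mx M q in Hab *.
exists (a + b / - Re l * mfro Q), (b / - Re l); split=> [||t p x t0].
- by rewrite addr_ge0 ?mulr_ge0 ?invr_ge0 ?mfro_ge0 // ltW.
- by rewrite divr_ge0 // ltW.
apply: le_trans (Hab t p x t0) _; rewrite mulrDl -addrA lerD2l.
rewrite -mulrA -mulrDr -mulrA ler_wpM2l // mulrC ler_pdivlMr //.
have lt : - Re l <= normc (t - l).
  apply: le_trans _ (le_normc_Re _).
  by case: (t) t0 (l) => [u v] /= u0 [u' v'] /=; apply: le_trans _ (ler_norm _); lra.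
apply: (@le_trans _ _ (mfro ((t - l) *: (Q *m x)))).
  by rewrite mfroZ mulrC ler_wpM2r ?mfro_ge0.
(* Since [Q] commutes with [M], [Q x] is traded for [(M - l) Q x], the next partial product, and
   [Q (M - t) x], which joins the first term of the bound. *)
have -> : (t - l) *: (Q *m x) =
    horner_mx M (('X - l%:P) * q) *m x - Q *m (M *m x - t *: x).
  rewrite rmorphM /= rmorphB /= horner_mx_X horner_mx_C -/Q.
  have MQ : M * Q = Q * M by rewrite -(horner_mx_X M) -!rmorphM mulrC.
  rewrite mulrBl MQ mulmxBr mulmxBl [_ * Q]mul_scalar_mx -scalemxAl -scalemxAr.
  rewrite -[Q * M]/(Q *m M) mulmxA scalerBl opprB [_ - l *: _]addrC -addrA.
  by rewrite [- _ + (_ - _)]addrA [RHS]addrC subrK.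
by apply: le_trans (mfroB _ _) _; rewrite addrC lerD2r mfroM.
Qed.

End Resolvent.

(** * Sylvester equations: a priori bound and injectivity *)

Section Sylvester.
Variable R : realType.
Local Notation C := R[i].
Local Notation normc := (@Normc.normc R).
Local Notation Re := (@complex.Re R).
Local Open Scope sesquilinear_scope.

(** [Schur] acts on rows and yields a lower triangular matrix; applied to the transpose, it gives an
    upper triangular [S] and a basis in the columns of [Q]. The diagonal entries are eigenvalues of
    [M]. *)
Lemma schur_basis n (M : 'M[C]_n) : exists Q S : 'M[C]_n,
  [/\ Q \is unitarymx, M *m Q = Q *m S,
      forall j k : 'I_n, (k < j)%N -> S j k = 0 &
      mstable M -> forall k, Re (S k k) < 0].
Proof.
case: n M => [|n] M.
  exists 1%:M, 0; split=> [||[]|_ []] //; last by rewrite [LHS]flatmx0 [RHS]flatmx0.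
  by apply/unitarymxP; rewrite [LHS]flatmx0 [RHS]flatmx0.
have [U uU] := Schur M^T (ltn0Sn n); rewrite /similar_to /= conjumx ?unitarymx_unit //.
set T := U *m _ *m _ => trT; exists U^T, T^T.
have TU : T *m U = U *m M^T by rewrite /T mulmxKV ?unitarymx_unit.
split; first by rewrite trmx_unitary.
- by apply: trmx_inj; rewrite !trmx_mul !trmxK TU.
- by move=> j k kj; rewrite mxE (is_trig_mxP trT).
move=> sM k; rewrite mxE.
have : root (char_poly T) (T k k).
  rewrite char_poly_trig // (bigD1 k) //= rootE hornerM hornerXsubC.
  by rewrite subrr mul0r.
rewrite -eigenvalue_root_char => /eigenvalueP [v vT v0].
apply: (sM _ (v *m U)^T).
  rewrite trmx_eq0; apply: contra v0 => /eqP vU.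
  by rewrite -[v](mulmxK (unitarymx_unit uU)) vU mul0mx.
apply: trmx_inj; rewrite trmx_mul trmxK linearZ /= trmxK.
by rewrite -mulmxA -TU mulmxA vT -scalemxAl.
Qed.

(* The right coefficient [F - G *m X] depends on the unknown, and only its
   spectrum is controlled. In a Schur basis q_1, ..., q_n of it, the equation
   becomes the triangular system
     (P + t_k) w_k = D q_k - \sum_(j < k) S_jk w_j   for w_k = X q_k,
   where |S_jk| <= |F q_k| + |G w_k|: for D small enough, the dependency of
   S_jk on w_k is absorbed in the left-hand side. *)
Lemma sylvester_apriori n (c m : R) : 0 < c -> 0 <= m ->
  exists B e0 : R, [/\ 0 <= B, 0 < e0 &
  forall (P F G X : 'M[C]_n) (eps : R), eps <= e0 ->
    (forall (t : C) (x : 'cV[C]_n), Re t < 0 ->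
       c * mfro x <= mfro (P *m x + t *: x)) ->
    mfro F <= m -> mfro G <= m -> mstable (F - G *m X) ->
    mfro (P *m X + X *m (F - G *m X)) <= eps ->
    mfro X <= B * eps].
Proof.
move=> c0 m0.
(* [b k * eps] will bound the first [k] columns. The next column satisfies
   [c |w| <= eps + n m (b k) eps (1 + |w|)]; once [n m (b k) eps <= c / 2], this gives
   [|w| <= 2 (1 + n m (b k)) eps / c]. *)
pose b k : R := iter k (fun b => b + 2 * (1 + n%:R * m * b) / c) 0.
have bS k : b k.+1 = b k + 2 * (1 + n%:R * m * b k) / c by [].
have nm0 : 0 <= n%:R * m by rewrite mulr_ge0 ?ler0n.
have b0 k : 0 <= b k.
  elim: k => // k IHk; rewrite bS addr_ge0 // divr_ge0 ?(ltW c0) //.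
  by rewrite mulr_ge0 // addr_ge0 // mulr_ge0.
have bmono j k : (j <= k)%N -> b j <= b k.
  move=> /subnK <-; elim: (k - j)%N => // d IHd; apply: le_trans IHd _.
  rewrite addSn bS lerDl divr_ge0 ?(ltW c0) //.
  by rewrite mulr_ge0 // addr_ge0 // mulr_ge0.
have nmb0 k : 0 <= n%:R * m * b k by rewrite mulr_ge0.
(* The threshold ensures [n m (b n) eps <= c / 2]. The factor [n] is a crude substitute for the
   square root of [n] that comes from assembling [n] columns. *)
exists (n%:R * b n), (c / (2 * (n%:R * m * b n + 1))); split.
- by rewrite mulr_ge0 ?ler0n.
- by rewrite divr_gt0 // mulr_gt0 // ltr_wpDl.
move=> P F G X eps ee0 Pc Fm Gm sA; set D := _ + _ => De.
have eps0 : 0 <= eps := le_trans (mfro_ge0 _) De.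
have [Q [S [uQ AQ Strig Sdiag]]] := schur_basis (F - G *m X).
pose q k := col k Q; pose w k := X *m q k.
have mq k : mfro (q k) = 1.
  by rewrite /q colE mfro_unitaryl ?mfro_delta.
have Aq k : (F - G *m X) *m q k = \sum_j S j k *: q j.
  rewrite /q colE mulmxA AQ -mulmxA -colE; apply/matrixP => i z.
  rewrite !mxE summxE; apply: eq_bigr => j _.
  by rewrite !mxE mulrC.
(* [S] is the conjugate of [F - G *m X] by the unitary [Q], so an entry of its column [k] is at most
   the norm of [(F - G *m X) *m q k]. *)
have Sle j k : normc (S j k) <= m * (1 + mfro (w k)).
  have -> : S = Q^t* *m ((F - G *m X) *m Q).
    by rewrite AQ mulmxA -invmx_unitary // mulVmx ?unitarymx_unit ?mul1mx.
  have -> : (Q^t* *m ((F - G *m X) *m Q)) j k =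
      (Q^t* *m ((F - G *m X) *m q k)) j 0.
    by rewrite /q colE !mulmxA -colE [RHS]mxE.
  apply: le_trans (normc_le_mfro _ _ _) _.
  rewrite mfro_unitaryl ?trmxC_unitary // mulmxBl -mulmxA.
  apply: le_trans (mfroB _ _) _; rewrite mulrDr lerD //.
    by apply: le_trans (mfroM _ _) _; rewrite mq !mulr1.
  by apply: le_trans (mfroM _ _) _; rewrite ler_wpM2r ?mfro_ge0.
have we k : P *m w k + S k k *: w k = D *m q k - \sum_(j < n | (j < k)%N) S j k *: w j.
  apply/eqP; rewrite eq_sym subr_eq; apply/eqP.
  rewrite /D mulmxDl -!mulmxA Aq -addrA; congr (_ + _).
  rewrite mulmx_sumr (bigD1 k) //= -scalemxAr; congr (_ + _).
  rewrite (bigID (fun j : 'I_n => (j < k)%N)) /= [X in _ + X]big1 ?addr0.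
    apply: eq_big => [j|j _]; last by rewrite -scalemxAr.
    by rewrite -val_eqE /= ltn_neqAle; case: eqP.
  move=> j /andP[jk]; rewrite -leqNgt leq_eqVlt eq_sym => /predU1P[|kj].
    by move/val_inj=> E; rewrite E eqxx in jk.
  by rewrite Strig // scale0r mulmx0.
have wb k : (k <= n)%N -> forall j : 'I_n, (j < k)%N -> mfro (w j) <= b k * eps.
  elim: k => // k IHk kn j; rewrite ltnS leq_eqVlt => /predU1P[jk|jk]; last first.
    apply: le_trans (IHk (ltnW kn) j jk) _.
    by rewrite ler_wpM2r ?bmono.
  have small : n%:R * m * b k * eps <= c / 2.
    apply: (@le_trans _ _ (n%:R * m * b n * eps)).
      by rewrite ler_wpM2r // ler_wpM2l // bmono // ltnW.
    apply: le_trans (ler_wpM2l (nmb0 n) ee0) _.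
    rewrite mulrA ler_pdivrMr; last by rewrite mulr_gt0 // ltr_wpDl.
    have := nmb0 n; move: (n%:R * m * b n) => z z0; nra.
  have cw : c * mfro (w j) <= eps + n%:R * m * b k * eps * (1 + mfro (w j)).
    apply: le_trans (Pc (S j j) _ (Sdiag sA j)) _; rewrite we.
    apply: le_trans (mfroB _ _) _; rewrite lerD //.
      by apply: le_trans (mfroM _ _) _; rewrite mq mulr1.
    apply: le_trans (mfro_sum _ _) _.
    apply: (@le_trans _ _ (\sum_(i < n) m * (1 + mfro (w j)) * (b k * eps))).
      rewrite [leLHS]big_mkcond /=; apply: ler_sum => i _.
      have pos : 0 <= m * (1 + mfro (w j)) by rewrite mulr_ge0 // addr_ge0 ?mfro_ge0.
      case: ifP => [ij|_]; last by apply: mulr_ge0 pos _; exact: mulr_ge0.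
      rewrite mfroZ ler_pM ?normc_ge0 ?mfro_ge0 ?Sle //.
      by rewrite IHk ?(ltnW kn) // -jk.
    by rewrite sumr_const card_ord -mulr_natl le_eqVlt; apply/orP; left; apply/eqP; ring.
  have half : c / 2 * mfro (w j) <= eps * (1 + n%:R * m * b k).
    have := mfro_ge0 (w j); move: (mfro (w j)) cw small => y.
    move: (n%:R * m * b k) => z; nra.
  rewrite bS mulrDl; apply: ler_wpDl; first by rewrite mulr_ge0.
  rewrite mulrAC ler_pdivlMr //; lra.
rewrite -(mfro_unitaryr _ uQ).
have wn j : mfro (w j) <= b n * eps by exact: wb.
rewrite -(@ler_pXn2r _ 2) ?nnegrE ?mfro_ge0 ?mulr_ge0 ?ler0n // sqr_mfro_col.
have -> : \sum_k mfro (col k (X *m Q)) ^+ 2 = \sum_k mfro (w k) ^+ 2.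
  by apply: eq_bigr => k _; rewrite /w /q !colE mulmxA.
apply: (@le_trans _ _ (\sum_(k < n) (b n * eps) ^+ 2)).
  by apply: ler_sum => k _; rewrite lerXn2r ?nnegrE ?mfro_ge0 ?mulr_ge0.
rewrite sumr_const card_ord -mulrA -[leLHS]mulr_natl [leRHS]exprMn ler_wpM2r ?sqr_ge0 //.
by rewrite -natrX ler_nat; case: (n) => // z; rewrite -mulnn leq_pmulr.
Qed.

(** The a priori bound with [F = M], [G = 0] and [eps = 0] leaves only [X = 0]. *)
Lemma sylvester_inj n (P M X : 'M[C]_n) :
  mstable P -> mstable M -> P *m X + X *m M = 0 -> X = 0.
Proof.
move=> sP sM PX; have [c c0 Pc] := resolvent_bound sP.
have [B [e0 [_ e00 H]]] := sylvester_apriori n c0 (mfro_ge0 M).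
apply/mfro_eq0/eqP; rewrite eq_le mfro_ge0 andbT -(mulr0 B).
apply: (H P M 0); rewrite ?mul0mx ?subr0 ?PX ?mfro0 ?mfro_ge0 ?(ltW e00) //.
move=> t x t0; rewrite -[t]opprK scaleNr; apply: Pc.
by case: t t0 => u v /= u0; lra.
Qed.

End Sylvester.

(** * Tensors as matrices, and the spectral norm *)

Section TensorMatrix.
Variables (R : realType) (N : nat).
Local Notation C := R[i].
Local Notation normc := (@Normc.normc R).
Local Notation Re := (@complex.Re R).
Local Open Scope sesquilinear_scope.
Implicit Types I J L : dims N.

(** Enumerating the multi-indices carries [*E] to the matrix product, so that the algebraic laws of
    tensors follow from those of matrices by injectivity. *)
Definition tomx I J (A : ptensor R I J) : 'M[C]_(#|midx I|, #|midx J|) :=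
  \matrix_(i, j) A (enum_val i, enum_val j).

Definition ofmx I J (M : 'M[C]_(#|midx I|, #|midx J|)) : ptensor R I J :=
  [ffun p => M (enum_rank p.1) (enum_rank p.2)].

Lemma tomxK I J : cancel (@tomx I J) (@ofmx I J).
Proof. by move=> A; apply/ffunP => -[i j]; rewrite ffunE mxE /= !enum_rankK. Qed.

Lemma ofmxK I J : cancel (@ofmx I J) (@tomx I J).
Proof. by move=> M; apply/matrixP => i j; rewrite mxE ffunE /= !enum_valK. Qed.

Lemma tomx_inj I J : injective (@tomx I J).
Proof. exact: can_inj (@tomxK I J). Qed.

Lemma tomxM I J L (A : ptensor R I J) (B : ptensor R J L) :
  tomx (A *E B) = tomx A *m tomx B.
Proof.
apply/matrixP => i k; rewrite !mxE ffunE /= (reindex (@enum_val _ (midx J))) /=.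
  by apply: eq_bigr => j _; rewrite !mxE.
by apply: onW_bij; exact: enum_val_bij.
Qed.

Lemma tomxD I J (A B : ptensor R I J) : tomx (A + B) = tomx A + tomx B.
Proof. by apply/matrixP => i j; rewrite !mxE ffunE. Qed.

Lemma tomxN I J (A : ptensor R I J) : tomx (- A) = - tomx A.
Proof. by apply/matrixP => i j; rewrite !mxE ffunE. Qed.

Lemma tomx0 I J : tomx (0 : ptensor R I J) = 0.
Proof. by apply/matrixP => i j; rewrite !mxE ffunE. Qed.

Lemma tomx1 I : tomx (tid R I) = 1%:M.
Proof. by apply/matrixP => i j; rewrite !mxE ffunE /= (inj_eq enum_val_inj). Qed.

Lemma tomxZ I J c (A : ptensor R I J) : tomx (tscale c A) = c *: tomx A.
Proof. by apply/matrixP => i j; rewrite !mxE ffunE. Qed.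

Lemma tomxH I J (A : ptensor R I J) : tomx A^H = (tomx A)^t*.
Proof. by apply/matrixP => i j; rewrite !mxE !ffunE. Qed.

Definition tomxE := (tomxM, tomxD, tomxN, tomx0, tomx1, tomxZ, tomxH).

Lemma fro_tomx I J (A : ptensor R I J) : fro A = mfro (tomx A).
Proof.
rewrite /mfro (@l2_reindex R _ _ (fun p => (enum_rank p.1, enum_rank p.2))).
  by apply: (@eq_l2 _ _ A) => -[i j]; rewrite /= mxE !enum_rankK.
exists (fun p => (enum_val p.1, enum_val p.2)) => -[i j] /=.
  by rewrite !enum_rankK.
by rewrite !enum_valK.
Qed.

Lemma fro_ge0 I J (A : ptensor R I J) : 0 <= fro A.
Proof. exact: l2_ge0. Qed.

Lemma fro_eq0 I J (A : ptensor R I J) : fro A = 0 -> A = 0.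
Proof. by rewrite fro_tomx => /mfro_eq0 A0; apply: tomx_inj; rewrite A0 tomx0. Qed.

Lemma fro_gt0 I J (A : ptensor R I J) : A != 0 -> 0 < fro A.
Proof.
by rewrite lt_def fro_ge0 andbT; apply: contra => /eqP/fro_eq0 ->.
Qed.

Lemma fro0 I J : fro (0 : ptensor R I J) = 0.
Proof. by rewrite fro_tomx tomx0 mfro0. Qed.

Lemma froD I J (A B : ptensor R I J) : fro (A + B) <= fro A + fro B.
Proof. by rewrite !fro_tomx tomxD mfroD. Qed.

Lemma froN I J (A : ptensor R I J) : fro (- A) = fro A.
Proof. by rewrite !fro_tomx tomxN mfroN. Qed.

Lemma froB I J (A B : ptensor R I J) : fro (A - B) <= fro A + fro B.
Proof. by rewrite -[fro B]froN; exact: froD. Qed.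

Lemma froZ I J c (A : ptensor R I J) : fro (tscale c A) = normc c * fro A.
Proof. by rewrite !fro_tomx tomxZ mfroZ. Qed.

Lemma froM I J L (A : ptensor R I J) (B : ptensor R J L) :
  fro (A *E B) <= fro A * fro B.
Proof. by rewrite !fro_tomx tomxM mfroM. Qed.

Lemma froH I J (A : ptensor R I J) : fro A^H = fro A.
Proof.
have -> : fro A = l2 (fun p => A (p.2, p.1)).
  by rewrite /fro -/(l2 A) (@l2_reindex R _ _ (fun p => (p.2, p.1))) //;
    exists (fun p => (p.2, p.1)) => -[].
by congr Num.sqrt; apply: eq_bigr => p _; rewrite !ffunE normc_conj.
Qed.

Lemma einA I J K L (A : ptensor R I J) (B : ptensor R J K) (D : ptensor R K L) :
  A *E (B *E D) = A *E B *E D.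
Proof. by apply: tomx_inj; rewrite !tomxE mulmxA. Qed.

Lemma einDl I J K (A B : ptensor R I J) (D : ptensor R J K) :
  (A + B) *E D = A *E D + B *E D.
Proof. by apply: tomx_inj; rewrite !tomxE mulmxDl. Qed.

Lemma einDr I J K (D : ptensor R I J) (A B : ptensor R J K) :
  D *E (A + B) = D *E A + D *E B.
Proof. by apply: tomx_inj; rewrite !tomxE mulmxDr. Qed.

Lemma einNl I J K (A : ptensor R I J) (D : ptensor R J K) :
  (- A) *E D = - (A *E D).
Proof. by apply: tomx_inj; rewrite !tomxE mulNmx. Qed.

Lemma einNr I J K (D : ptensor R I J) (A : ptensor R J K) :
  D *E (- A) = - (D *E A).
Proof. by apply: tomx_inj; rewrite !tomxE mulmxN. Qed.

Lemma einZl I J K c (A : ptensor R I J) (D : ptensor R J K) :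
  tscale c A *E D = tscale c (A *E D).
Proof. by apply: tomx_inj; rewrite !tomxE scalemxAl. Qed.

Lemma einZr I J K c (D : ptensor R I J) (A : ptensor R J K) :
  D *E tscale c A = tscale c (D *E A).
Proof. by apply: tomx_inj; rewrite !tomxE scalemxAr. Qed.

Lemma ein0l I J K (D : ptensor R J K) : (0 : ptensor R I J) *E D = 0.
Proof. by apply: tomx_inj; rewrite !tomxE mul0mx. Qed.

Lemma ein0r I J K (D : ptensor R I J) : D *E (0 : ptensor R J K) = 0.
Proof. by apply: tomx_inj; rewrite !tomxE mulmx0. Qed.

Lemma ein1l I J (A : ptensor R I J) : tid R I *E A = A.
Proof. by apply: tomx_inj; rewrite !tomxE mul1mx. Qed.

Lemma ein1r I J (A : ptensor R I J) : A *E tid R J = A.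
Proof. by apply: tomx_inj; rewrite !tomxE mulmx1. Qed.

Lemma tadjM I J K (A : ptensor R I J) (B : ptensor R J K) :
  (A *E B)^H = B^H *E A^H.
Proof. by apply: tomx_inj; rewrite !tomxE trmx_mul map_mxM. Qed.

Lemma tadjD I J (A B : ptensor R I J) : (A + B)^H = A^H + B^H.
Proof. by apply: tomx_inj; rewrite !tomxE linearD map_mxD. Qed.

Lemma tadjN I J (A : ptensor R I J) : (- A)^H = - A^H.
Proof. by apply: tomx_inj; rewrite !tomxE linearN map_mxN. Qed.

Lemma tadjZ I J c (A : ptensor R I J) : (tscale c A)^H = tscale c^*%C A^H.
Proof. by apply/ffunP => p; rewrite !ffunE rmorphM. Qed.

Lemma tadjK I J (A : ptensor R I J) : (A^H)^H = A.
Proof. by apply/ffunP => -[i j]; rewrite !ffunE /= conjcK. Qed.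

Lemma tscaleA I J c d (A : ptensor R I J) :
  tscale c (tscale d A) = tscale (c * d) A.
Proof. by apply/ffunP => p; rewrite !ffunE mulrA. Qed.

Lemma tscale0l I J (A : ptensor R I J) : tscale 0 A = 0.
Proof. by apply/ffunP => p; rewrite !ffunE mul0r. Qed.

Lemma tscale1 I J (A : ptensor R I J) : tscale 1 A = A.
Proof. by apply/ffunP => p; rewrite !ffunE mul1r. Qed.

Lemma taddE I J (A B : ptensor R I J) p : (A + B) p = A p + B p.
Proof. by rewrite ffunE. Qed.

Lemma toppE I J (A : ptensor R I J) p : (- A) p = - A p.
Proof. by rewrite ffunE. Qed.

Lemma tscaleE I J c (A : ptensor R I J) p : tscale c A p = c * A p.
Proof. by rewrite ffunE. Qed.

Lemma tzeroE I J p : (0 : ptensor R I J) p = 0.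
Proof. by rewrite ffunE. Qed.

Lemma midx_ones_eq (p q : midx (ones N)) : p = q.
Proof. by apply/ffunP => n; rewrite [p n]ord1 [q n]ord1. Qed.

Definition one_idx : midx (ones N) := [ffun n => ord0].

Lemma ein_adj_self I (Y : vtensor R I) p : (Y^H *E Y) p = (fro Y ^+ 2)%:C.
Proof.
rewrite ffunE sqr_l2_pair rmorph_sum; apply: eq_bigr => i _.
rewrite !ffunE /= sqr_l2 (bigD1 p.2) //= big1 ?addr0; last first.
  by move=> q; rewrite (midx_ones_eq q p.2) eqxx.
by rewrite sqr_normcE (midx_ones_eq p.1 p.2).
Qed.

(** The matrix of a [vtensor] has [#|midx (ones N)|] columns, a number equal to 1 but not of that
    form: the only column is extracted by [delta_mx] in one direction, and [x] is copied to every
    column in the other. *)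
Lemma UeigenvalueP I (A : ptensor R I I) (l : C) :
  Ueigenvalue A l <-> exists2 x : 'cV[C]_(#|midx I|), x != 0 &
    tomx A *m x = l *: x.
Proof.
split=> -[].
  move=> X X0 AX; exists (tomx X *m delta_mx (enum_rank one_idx) 0).
    apply: contra X0 => /eqP /matrixP X0; apply/eqP/ffunP => -[i q].
    have := X0 (enum_rank i) 0; rewrite -colE !mxE !enum_rankK ffunE => <-.
    by rewrite (midx_ones_eq q one_idx).
  by rewrite mulmxA -tomxM AX tomxZ scalemxAl.
move=> x x0 Ax; exists (ofmx (\matrix_(i, j) x i 0)).
  apply: contra x0 => /eqP/(congr1 (@tomx _ _)); rewrite ofmxK tomx0.
  move/matrixP => x0; apply/eqP/matrixP => i j.
  by have := x0 i (enum_rank one_idx); rewrite !mxE ord1.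
apply: tomx_inj; rewrite tomxM tomxZ ofmxK; apply/matrixP => i j.
have /matrixP/(_ i 0) := Ax; rewrite !mxE => <-.
by apply: eq_bigr => k _; rewrite !mxE.
Qed.

Lemma stableP I (A : ptensor R I I) : stable A <-> mstable (tomx A).
Proof.
split=> sA l; last by move/UeigenvalueP => [x x0 /sA]; exact.
by move=> x x0 Ax; apply/sA/UeigenvalueP; exists x.
Qed.

(** The adjoint of an eigenvector is a left eigenvector of [M] for the conjugate eigenvalue, whose
    real part is the same. *)
Lemma mstable_adj n (M : 'M[C]_n) : mstable M -> mstable (M^t*).
Proof.
move=> sM l x x0 Mx; have -> : Re l = Re l^*%C by case: l {Mx}.
apply: (mstable_root sM); rewrite -eigenvalue_root_char.
apply/eigenvalueP; exists (x^t*).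
  have := congr1 (fun X => X^t*) Mx.
  by rewrite trmx_mul map_mxM trmxCK linearZ /= map_mxZ.
apply: contra x0 => /eqP x0; apply/eqP; rewrite -[x]trmxCK x0.
by rewrite trmx0 map_mx0.
Qed.

(** Diagonalizing [M^H *E M] by a unitary [U] writes the squared left-hand side as a combination of
    the squared row norms of [U X], with the eigenvalues as weights; each weight is at most
    [lambda_max]. *)
Lemma fro_ein_le I J L (M : ptensor R I J) (X : ptensor R J L) :
  fro (M *E X) <= spectral_norm M * fro X.
Proof.
have [lam Dlam] : {lam | lam = lambda_max (M^H *E M)} by exists (lambda_max (M^H *E M)).
suff le2 : fro (M *E X) ^+ 2 <= lam * fro X ^+ 2.
  rewrite -(@ler_pXn2r _ 2) ?nnegrE ?mulr_ge0 ?sqrtr_ge0 ?fro_ge0 //.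
  apply: le_trans le2 _; rewrite exprMn ler_wpM2r ?sqr_ge0 // /spectral_norm -Dlam.
  by case: (leP 0 lam) => l0; [rewrite sqr_sqrtr | rewrite (le_trans (ltW l0)) ?sqr_ge0].
set b := tomx (M^H *E M).
have bE : b = (tomx M)^t* *m tomx M by rewrite /b !tomxE.
have bn : b \is normalmx.
  by apply/normalmxP; rewrite bE trmx_mul map_mxM trmxCK.
move: (orthomx_spectralP bn) => {bn}.
have := spectral_unitarymx b; move: (spectralmx b) (spectral_diag b) => U d uU bU.
have eig i : b *m (invmx U *m delta_mx i 0) = d 0 i *: (invmx U *m delta_mx i (0 : 'I_1)).
  rewrite bU -!mulmxA mulKVmx ?unitarymx_unit // scalemxAr; congr (_ *m _).
  by rewrite -colE; apply/matrixP => j k; rewrite !mxE ord1 eqxx andbT;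
    case: eqVneq => [->|]; rewrite ?mulr1n ?mulr1 ?mulr0n ?mulr0.
have eig1 i : mfro (invmx U *m delta_mx i (0 : 'I_1)) = 1.
  by rewrite invmx_unitary // mfro_unitaryl ?trmxC_unitary // mfro_delta.
(* Each diagonal entry is [|M u|^2] for a unit eigenvector [u]. It is therefore real and belongs to
   the set whose supremum is [lambda_max]. *)
have dE i : d 0 i = (mfro (tomx M *m (invmx U *m delta_mx i (0 : 'I_1))) ^+ 2)%:C.
  rewrite sqr_mfroE trmx_mul map_mxM -mulmxA [_ *m (tomx M *m _)]mulmxA -bE eig.
  by rewrite -scalemxAr mxtraceZ -sqr_mfroE eig1 expr1n mulr1.
(* Without an upper bound, [sup] would not dominate the elements of the set. *)
have ub : has_ubound [set x : R | Ueigenvalue (M^H *E M) x%:C].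
  exists (mfro b) => r /UeigenvalueP [x x0 bx].
  have xp : 0 < mfro x.
    by rewrite lt_def mfro_ge0 andbT; apply: contra x0 => /eqP/mfro_eq0 ->.
  rewrite -(ler_pM2r xp); apply: le_trans (mfroM _ _); rewrite -/b bx mfroZ.
  by rewrite ler_wpM2r ?(ltW xp) // normc_real ler_norm.
have lamge i : complex.Re (d 0 i) <= lam.
  rewrite Dlam; apply: (ub_le_sup ub); apply/UeigenvalueP.
  exists (invmx U *m delta_mx i 0); last by rewrite -/b eig [in RHS]dE {1}dE.
  by apply/eqP => u0; have := eig1 i; rewrite u0 mfro0 => /eqP; rewrite eq_sym oner_eq0.
have -> : fro X = mfro (U *m tomx X) by rewrite mfro_unitaryl // fro_tomx.
have -> : fro (M *E X) ^+ 2 = \sum_i Re (d 0 i) * l2 (fun k => (U *m tomx X) i k) ^+ 2.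
  rewrite fro_tomx tomxM; apply: (@complexI R).
  rewrite sqr_mfroE trmx_mul map_mxM mulmxA -[_ *m _ *m tomx M]mulmxA -bE bU.
  rewrite invmx_unitary // !mulmxA -map_mxM -trmx_mul -!mulmxA.
  set Y := U *m tomx X; rewrite mxtrace_mulC -mulmxA mul_diag_mx /mxtrace rmorph_sum.
  apply: eq_bigr => i _; rewrite rmorphM /= dE mxE -dE; congr (_ * _).
  rewrite mxE sqr_l2 rmorph_sum /=; apply: eq_bigr => k _.
  by rewrite sqr_normcE !mxE mulrC.
rewrite [mfro _ ^+ 2]sqr_l2_pair mulr_sumr; apply: ler_sum => i _.
by rewrite ler_wpM2r ?sqr_ge0.
Qed.

(** Injectivity makes the matrix of [Z] invertible, so the set from which [tinv] chooses is
    inhabited and the default value 0 is avoided. *)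
Lemma tinvK I (Z : ptensor R I I) :
  (forall X : vtensor R I, Z *E X = 0 -> X = 0) -> tinv Z *E Z = tid R I.
Proof.
move=> Zinj; suff uZ : tomx Z \in unitmx.
  rewrite /tinv; case: xgetP => [D _ []//|] /(_ (ofmx (invmx (tomx Z)))) [].
  by split; apply: tomx_inj; rewrite tomxM ofmxK tomx1 ?mulmxV ?mulVmx.
rewrite -unitmx_tr -row_free_unit -kermx_eq0; apply/eqP/row_matrixP => k.
rewrite row0; set v := row k _.
have Zv : tomx Z *m v^T = 0.
  by apply: trmx_inj; rewrite trmx_mul trmxK trmx0 -row_mul mulmx_ker row0.
apply: trmx_inj; rewrite trmx0; apply/eqP/negPn/negP => v0.
have [|X X0] := (UeigenvalueP Z 0).2; first by exists v^T; rewrite // scale0r.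
by rewrite tscale0l => /Zinj /eqP; rewrite (negPf X0).
Qed.

End TensorMatrix.

(** * Kronecker products and vectorization *)

Section Kronecker.
Variables (R : realType) (N : nat).
Implicit Types I J K L : dims N.

Lemma midx_pair_subproof I J (k : midx I) (l : midx J) n :
  (k n * J n + l n < dims_mul I J n)%N.
Proof.
rewrite /dims_mul; have := ltn_ord (k n); have := ltn_ord (l n).
move: (nat_of_ord (k n)) (nat_of_ord (l n)) => a b bJ aI.
by rewrite (@leq_trans (a.+1 * J n)) ?leq_mul2r ?aI ?orbT // mulSn addnC ltn_add2r.
Qed.

Definition midx_pair I J (k : midx I) (l : midx J) : midx (dims_mul I J) :=
  [ffun n => Ordinal (midx_pair_subproof k l n)].

Lemma midx_pair_quo I J (k : midx I) (l : midx J) :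
  midx_quo (midx_pair k l) = k.
Proof.
apply/ffunP => n; apply/val_inj; rewrite !ffunE /=.
by rewrite divnMDl ?divn_small ?addn0 ?ltn_ord // (leq_ltn_trans _ (ltn_ord (l n))).
Qed.

Lemma midx_pair_rem I J (k : midx I) (l : midx J) :
  midx_rem (midx_pair k l) = l.
Proof.
apply/ffunP => n; apply/val_inj; rewrite !ffunE /=.
by rewrite modnMDl modn_small ?ltn_ord.
Qed.

Lemma midx_pairK I J (p : midx (dims_mul I J)) :
  midx_pair (midx_quo p) (midx_rem p) = p.
Proof. by apply/ffunP => n; apply/val_inj; rewrite !ffunE /= !ffunE /= -divn_eq. Qed.

(* Column-major vectorization: the row index of M is the fast one. *)
Definition tvec I J (M : ptensor R I J) : vtensor R (dims_mul J I) :=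
  [ffun p => M (midx_rem p.1, midx_quo p.1)].

Lemma fro_tvec I J (M : ptensor R I J) : fro (tvec M) = fro M.
Proof.
rewrite /fro -/(l2 M) -/(l2 (tvec M)).
rewrite (@l2_reindex R _ _ (fun p : midx I * midx J =>
  (midx_pair p.2 p.1, one_idx N))).
  by apply: eq_l2 => -[i j]; rewrite /= ffunE /= midx_pair_quo midx_pair_rem.
exists (fun p => (midx_rem p.1, midx_quo p.1)) => [[i j]|[i q]] /=.
  by rewrite midx_pair_quo midx_pair_rem.
by rewrite midx_pairK (midx_ones_eq q (one_idx N)).
Qed.

Lemma tvec_surj I J (X : vtensor R (dims_mul J I)) :
  exists M : ptensor R I J, X = tvec M.
Proof.
exists [ffun p => X (midx_pair p.2 p.1, one_idx N)].
by apply/ffunP => -[p q]; rewrite !ffunE /= midx_pairK (midx_ones_eq q (one_idx N)).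
Qed.

Lemma tvecD I J (A B : ptensor R I J) : tvec (A + B) = tvec A + tvec B.
Proof. by apply/ffunP => p; rewrite !ffunE. Qed.

Lemma tvecN I J (A : ptensor R I J) : tvec (- A) = - tvec A.
Proof. by apply/ffunP => p; rewrite !ffunE. Qed.

Lemma tvec_inj0 I J (A : ptensor R I J) : tvec A = 0 -> A = 0.
Proof. by move=> A0; apply: fro_eq0; rewrite -fro_tvec A0 fro0. Qed.

(** The classical identity [(X (x) Y) vec M = vec (Y M X^T)]: the summation index splits into its
    quotient and its remainder in every mode. *)
Lemma kron_tvec I J K L (X : ptensor R I J) (Y : ptensor R K L)
  (M : ptensor R L J) : (X *K Y) *E tvec M = tvec (Y *E M *E X^tr).
Proof.
apply/ffunP => -[p q]; rewrite !ffunE /=.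
rewrite (reindex (fun x : midx J * midx L => midx_pair x.1 x.2)) /=; last first.
  apply: onW_bij; exists (fun p => (midx_quo p, midx_rem p)) => [[k l]|i] /=.
    by rewrite midx_pair_quo midx_pair_rem.
  by rewrite midx_pairK.
rewrite -(pair_bigA _ (fun k l => (X *K Y) (p, midx_pair k l) *
  tvec M (midx_pair k l, q))) /=.
apply: eq_bigr => k _; rewrite !ffunE /= mulr_suml; apply: eq_bigr => l _.
by rewrite !ffunE /= midx_pair_quo midx_pair_rem; ring.
Qed.

Lemma ttrK I J (A : ptensor R I J) : (A^tr)^tr = A.
Proof. by apply/ffunP => -[i j]; rewrite !ffunE. Qed.

Lemma ttr_id I : (tid R I)^tr = tid R I.
Proof. by apply/ffunP => -[i j]; rewrite !ffunE /= eq_sym. Qed.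

End Kronecker.

(** * Block rows and block columns *)

Section Block.
Variables (R : realType) (N : nat).
Implicit Types I J K L : dims N.

Lemma block_quo_subproof p J (q : midx (block_dims p J)) :
  (q ord0 %/ J ord0 < p)%N.
Proof. by move: (q ord0); rewrite /block_dims eqxx => x; exact: kron_quo_subproof. Qed.

Definition block_of p J (q : midx (block_dims p J)) : 'I_p :=
  Ordinal (block_quo_subproof q).

Lemma block_idx_subproof p J (b : 'I_p) (j : midx J) (n : 'I_N.+1) :
  ((if n == ord0 then b * J n else 0) + j n < block_dims p J n)%N.
Proof.
rewrite /block_dims; case: eqP => _; last by rewrite add0n ltn_ord.
have := ltn_ord (j n); move: (nat_of_ord (j n)) => l lJ.
by rewrite (@leq_trans (b.+1 * J n)) ?leq_mul2r ?ltn_ord ?orbT // mulSn addnC ltn_add2r.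
Qed.

Definition block_idx p J (b : 'I_p) (j : midx J) : midx (block_dims p J) :=
  [ffun n => Ordinal (block_idx_subproof b j n)].

Lemma block_idx_of p J (b : 'I_p) (j : midx J) : block_of (block_idx b j) = b.
Proof.
apply/val_inj; rewrite /= ffunE /= divnMDl ?divn_small ?addn0 ?ltn_ord //.
by rewrite (leq_ltn_trans _ (ltn_ord (j ord0))).
Qed.

Lemma block_idx_col p J (b : 'I_p) (j : midx J) : block_col (block_idx b j) = j.
Proof.
apply/ffunP => n; apply/val_inj; rewrite !ffunE /=.
by case: ifP => _; rewrite ?modnMDl modn_small ?ltn_ord.
Qed.

Lemma block_idxK p J (q : midx (block_dims p J)) :
  block_idx (block_of q) (block_col q) = q.
Proof.
apply/ffunP => n; apply/val_inj; rewrite !ffunE /= !ffunE /=.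
case: eqP => [->|/eqP n0]; first by rewrite -divn_eq.
rewrite add0n modn_small //; move: (q n); rewrite /block_dims (negPf n0) => x.
exact: ltn_ord.
Qed.

Lemma block_idx_bij p J :
  bijective (fun x : 'I_p * midx J => block_idx x.1 x.2).
Proof.
exists (fun q => (block_of q, block_col q)) => [[b j]|q] /=.
  by rewrite block_idx_of block_idx_col.
by rewrite block_idxK.
Qed.

(** The column counterpart of [rowblock], concatenated along the first row mode so that the two
    multiply block by block. *)
Definition tstack p J L (Ys : 'I_p -> ptensor R J L) :
    ptensor R (block_dims p J) L :=
  [ffun q => Ys (block_of q.1) (block_col q.1, q.2)].

Lemma fro_tstack p J L (Ys : 'I_p -> ptensor R J L) :
  fro (tstack Ys) ^+ 2 = \sum_b fro (Ys b) ^+ 2.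
Proof.
rewrite sqr_l2_pair (reindex _ (onW_bij _ (block_idx_bij p J))) /=.
rewrite -(pair_bigA _ (fun b j => l2 (fun q => tstack Ys (block_idx b j, q)) ^+ 2)) /=.
apply: eq_bigr => b _; rewrite [RHS]sqr_l2_pair; apply: eq_bigr => j _.
by congr (_ ^+ 2); apply: eq_l2 => q; rewrite ffunE /= block_idx_of block_idx_col.
Qed.

Lemma fro_rowblock I J (Xs : seq (ptensor R I J)) :
  fro (rowblock Xs) ^+ 2 = \sum_(b < size Xs) fro (nth 0 Xs b) ^+ 2.
Proof.
have -> : fro (rowblock Xs) ^+ 2 =
    \sum_i \sum_(b < size Xs) \sum_j Normc.normc (nth 0 Xs b (i, j)) ^+ 2.
  rewrite sqr_l2_pair; apply: eq_bigr => i _; rewrite sqr_l2.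
  rewrite (reindex _ (onW_bij _ (block_idx_bij (size Xs) J))) /=.
  rewrite -(pair_bigA _ (fun b j => Normc.normc (rowblock Xs (i, block_idx b j)) ^+ 2)) /=.
  apply: eq_bigr => b _; apply: eq_bigr => j _; rewrite ffunE /= block_idx_col.
  by rewrite -[(_ %/ _)%N]/(nat_of_ord (block_of (block_idx b j))) block_idx_of.
rewrite exchange_big /=; apply: eq_bigr => b _; rewrite sqr_l2_pair.
by apply: eq_bigr => i _; rewrite sqr_l2.
Qed.

Lemma rowblock_tstack I J L (Xs : seq (ptensor R I J))
    (Ys : 'I_(size Xs) -> ptensor R J L) :
  rowblock Xs *E tstack Ys = \sum_(b < size Xs) nth 0 Xs b *E Ys b.
Proof.
apply/ffunP => -[i k]; rewrite ffunE /= sum_ffunE.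
rewrite (reindex _ (onW_bij _ (block_idx_bij (size Xs) J))) /=.
rewrite -(pair_bigA _ (fun b j => rowblock Xs (i, block_idx b j) *
  tstack Ys (block_idx b j, k))) /=.
apply: eq_bigr => b _; rewrite ffunE; apply: eq_bigr => j _.
rewrite !ffunE /= block_idx_of block_idx_col.
by have /(congr1 val) := block_idx_of b j; rewrite /= ffunE /= => ->.
Qed.

End Block.

(** * Expansion of the Riccati equation, stability and a priori bounds *)

Section RiccatiPerturbation.
Variables (R : realType) (N : nat).
Local Notation C := R[i].
Local Notation Re := (@complex.Re R).
Implicit Types I J L : dims N.

(** The derivative of the Riccati residual with respect to [E]. With [ric1], the derivative with
    respect to the coefficients, it forms the part of degree 1 in [(dA, dG, dK, H)]; [ric2] and
    [ric3] are the parts of degrees 2 and 3. *)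
Definition lyapunov I (A G E H : ptensor R I I) : ptensor R I I :=
  (A - G *E E)^H *E H + H *E (A - G *E E).

Definition ric1 I (E dA dG dK : ptensor R I I) : ptensor R I I :=
  dA^H *E E + E *E dA - E *E dG *E E + dK.

Definition ric2 I (G E dA dG H : ptensor R I I) : ptensor R I I :=
  dA^H *E H + H *E dA - H *E G *E H - E *E dG *E H - H *E dG *E E.

Definition ric3 I (dG H : ptensor R I I) : ptensor R I I :=
  - (H *E dG *E H).

Definition einE := (einDl, einDr, einNl, einNr, einZl, einZr, einA).

Definition entryE := (taddE, toppE, tscaleE, tzeroE).

Lemma riccati_expand I (A G K E dA dG dK H : ptensor R I I) (t : R) :
  E^H = E -> G^H = G ->
  riccati (A + tscale t%:C dA) (G + tscale t%:C dG) (K + tscale t%:C dK)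
    (E + tscale t%:C H) =
  riccati A G K E + tscale t%:C (lyapunov A G E H + ric1 E dA dG dK) +
  tscale (t ^+ 2)%:C (ric2 G E dA dG H) + tscale (t ^+ 3)%:C (ric3 dG H).
Proof.
move=> hE hG; rewrite /riccati /lyapunov /ric1 /ric2 /ric3.
rewrite !(tadjD, tadjN, tadjZ, tadjM, conjc_real, hE, hG) !einE.
by apply/ffunP => p; rewrite !entryE !rmorphXn /=; ring.
Qed.

(** An exact identity: the cross terms [E *E G *E X] cancel. The left coefficient involves only [E]
    and the right one only [X], which is the closed-loop tensor of [X]. *)
Lemma riccati_diff I (A G K E X : ptensor R I I) :
  (A^H - E *E G) *E (X - E) + (X - E) *E (A - G *E X) =
  riccati A G K X - riccati A G K E.
Proof.
rewrite /riccati !einE; apply/ffunP => p; rewrite !entryE; ring.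
Qed.

(** Testing the Riccati equation on an eigenvector [X] with [0 <= Re l] gives a vanishing sum of the
    nonnegative terms [2 Re l X^H E X], [|B^H E X|^2] and [|D X|^2]. Hence [X] is an eigenvector of
    [A] in the kernel of [D], which detectability excludes. *)
Lemma closed_loop_stable I J L (A E : ptensor R I I) (B : ptensor R I J)
    (D : ptensor R L I) :
  detectable D A -> psd E -> riccati A (B *E B^H) (D^H *E D) E = 0 ->
  stable (A - B *E B^H *E E).
Proof.
move=> det [hE pE] ric; have [M ME] : {M | M = A - B *E B^H *E E} by eexists.
rewrite -ME => l [X X0 MX].
rewrite ltNge; apply/negP => l0; case/negP: X0; apply/eqP.
pose p := (one_idx N, one_idx N).
have sum0 : tscale (l^*%C + l) (X^H *E E *E X) +
    (B^H *E E *E X)^H *E (B^H *E E *E X) + (D *E X)^H *E (D *E X) = 0.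
  have : X^H *E riccati A (B *E B^H) (D^H *E D) E *E X = 0.
    by rewrite ric ein0r ein0l.
  have -> : riccati A (B *E B^H) (D^H *E D) E =
      M^H *E E + E *E M + E *E B *E B^H *E E + D^H *E D.
    rewrite /riccati ME !(tadjD, tadjN, tadjM, tadjK, hE) !einE.
    by apply/ffunP => x; rewrite !entryE; ring.
  have XM : X^H *E M^H = tscale l^*%C X^H by rewrite -tadjM MX tadjZ.
  move=> <-; rewrite !(tadjM, tadjK, hE) !einE XM -[X^H *E E *E M *E X]einA MX !einE.
  by apply/ffunP => x; rewrite !entryE; ring.
have [q q0 qE] : exists2 q : R, 0 <= q & (X^H *E E *E X) p = q%:C.
  have := pE X p; case: ((X^H *E E *E X) p) => a b; rewrite lecE /= => /andP[/eqP -> a0].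
  by exists a.
have := congr1 (fun T : vtensor R (ones N) => Re (T p)) sum0.
rewrite /= !entryE !ein_adj_self qE.
have -> : Re ((l^*%C + l) * q%:C + (fro (B^H *E E *E X) ^+ 2)%:C +
  (fro (D *E X) ^+ 2)%:C) = 2 * Re l * q + fro (B^H *E E *E X) ^+ 2 +
  fro (D *E X) ^+ 2.
  by case: l {l0 MX sum0} => a b /=; ring.
have lq : 0 <= Re l * q by exact: mulr_ge0.
move=> s0; have [f1 f2] : fro (B^H *E E *E X) ^+ 2 = 0 /\ fro (D *E X) ^+ 2 = 0.
  have := sqr_ge0 (fro (B^H *E E *E X)); have := sqr_ge0 (fro (D *E X)).
  by split; lra.
have {f1} B0 : B^H *E E *E X = 0 by apply/fro_eq0/eqP; rewrite -sqrf_eq0 f1.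
have {f2} D0 : D *E X = 0 by apply/fro_eq0/eqP; rewrite -sqrf_eq0 f2.
(* As [B^H *E E *E X] vanishes, the feedback term disappears and [A *E X] equals [M *E X]. *)
apply: det l0 _ D0; rewrite -MX ME einDl einNl -!einA [B^H *E (E *E X)]einA B0.
by rewrite ein0r subr0.
Qed.

Lemma stable_adj I (A : ptensor R I I) : stable A -> stable A^H.
Proof. by move/stableP => sA; apply/stableP; rewrite tomxH; exact: mstable_adj. Qed.

Lemma sylvester_tensor_inj I (P M X : ptensor R I I) :
  stable P -> stable M -> P *E X + X *E M = 0 -> X = 0.
Proof.
move=> /stableP sP /stableP sM PX; apply: tomx_inj; rewrite tomx0.
by apply: sylvester_inj sP sM _; rewrite -!tomxE PX tomx0.
Qed.

(** By [riccati_diff], [X - E] solves a homogeneous Sylvester equation with two stable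
    coefficients. *)
Lemma stabilizing_unique I (A G K E X : ptensor R I I) :
  E^H = E -> G^H = G -> riccati A G K E = 0 -> riccati A G K X = 0 ->
  stable (A - G *E E) -> stable (A - G *E X) -> X = E.
Proof.
move=> hE hG rE rX sE sX; apply/eqP; rewrite -subr_eq0; apply/eqP.
apply: sylvester_tensor_inj (stable_adj sE) sX _.
by rewrite tadjD tadjN tadjM hE hG (riccati_diff A G K) rE rX subr0.
Qed.

(** The radius is the constant of [resolvent_bound]: an eigenvector of [M + D] for [l] satisfies
    [M x - l x = - D x], too small when [0 <= Re l]. *)
Lemma stable_open I (M : ptensor R I I) : stable M ->
  exists2 r : R, 0 < r & forall D : ptensor R I I, fro D < r -> stable (M + D).
Proof.
move=> /stableP sM; have [c c0 H] := resolvent_bound sM; exists c => // D Dc.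
apply/stableP => l x x0 Mx; rewrite ltNge; apply/negP => l0.
have := H l _ x l0; apply/negP; rewrite -ltNge.
have -> : tomx M *m x - l *: x = - (tomx D *m x).
  by rewrite -Mx tomxD mulmxDl opprD addrA subrr add0r.
rewrite mfroN; apply: le_lt_trans (mfroM _ _) _; rewrite -fro_tomx ltr_pM2r //.
by rewrite lt_def mfro_ge0 andbT; apply: contra x0 => /eqP/mfro_eq0 ->.
Qed.

(* The difference of two solutions satisfies a Sylvester equation whose left
   coefficient does not depend on the perturbed solution X. *)
Lemma stabilizing_apriori I (A G K E : ptensor R I I) :
  E^H = E -> G^H = G -> riccati A G K E = 0 -> stable (A - G *E E) ->
  exists B e0 : R, [/\ 0 <= B, 0 < e0 &
  forall (dA dG dK X : ptensor R I I) (e : R), e <= e0 ->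
    fro dA <= e -> fro dG <= e -> fro dK <= e ->
    riccati (A + dA) (G + dG) (K + dK) X = 0 ->
    stable (A + dA - (G + dG) *E X) -> fro (X - E) <= B * e].
Proof.
move=> hE hG ric sE.
have [c c0 Hc] := resolvent_bound ((stableP _).1 (stable_adj sE)).
have E0 := fro_ge0 E.
(* [m] bounds [A + dA - (G + dG) *E E] and [G + dG] when [e <= 1]; [d * e] will bound [ric1]; below
   [e2], the left coefficient moves by at most [c / 2], so half of its constant [c] survives. *)
pose m := fro (A - G *E E) + fro G + 2 + fro E.
have m0 : 0 <= m by rewrite /m; have := fro_ge0 (A - G *E E); have := fro_ge0 G; lra.
have [|B [e1 [B0 e10 HB]]] := @sylvester_apriori R #|midx I| (c / 2) m _ m0; first lra.
pose d := 2 * fro E + fro E ^+ 2 + 1.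
have d0 : 0 < d by rewrite /d; have := sqr_ge0 (fro E); lra.
pose e2 := c / 2 / (1 + fro E).
have e20 : 0 < e2 by rewrite divr_gt0 //; lra.
exists (B * d), (Num.min 1 (Num.min e2 (e1 / d))); split.
- by rewrite mulr_ge0 // ltW.
- by rewrite !lt_min ltr01 e20 divr_gt0.
move=> dA dG dK X e; rewrite !le_min => /and3P[le1 le2 led] Ae Ge Ke ricX sX.
have e0 : 0 <= e := le_trans (fro_ge0 _) Ae.
rewrite -mulrA fro_tomx.
have dle : fro (dA - dG *E E) <= e * (1 + fro E).
  apply: le_trans (froB _ _) _; rewrite mulrDr mulr1 lerD //.
  by apply: le_trans (froM _ _) _; rewrite ler_wpM2r.
have dle' : fro (dA^H - E *E dG) <= e * (1 + fro E).
  apply: le_trans (froB _ _) _; rewrite froH mulrDr mulr1 lerD //.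
  by apply: le_trans (froM _ _) _; rewrite mulrC ler_wpM2r.
(* The closed-loop tensor of [X], put in the form [F - G *m X] of [sylvester_apriori] with unknown
   [X - E]. *)
have clE : (A + dA) - (G + dG) *E E - (G + dG) *E (X - E) =
    A + dA - (G + dG) *E X.
  by rewrite !einE; apply/ffunP => p; rewrite !entryE; ring.
have eE : e * fro E <= fro E by rewrite ler_piMl.
apply: (HB (tomx ((A + dA)^H - E *E (G + dG)))
  (tomx ((A + dA) - (G + dG) *E E)) (tomx (G + dG))).
- by rewrite mulrC -ler_pdivlMr.
- move=> t x t0.
  have : c * mfro x <= mfro (tomx (A - G *E E)^H *m x + t *: x).
    have := Hc (- t) _ x; rewrite scaleNr opprK; apply.
    by case: (t) t0 => u v /= u0; lra.
  have -> : tomx (A - G *E E)^H *m x + t *: x =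
      (tomx ((A + dA)^H - E *E (G + dG)) *m x + t *: x) -
      tomx (dA^H - E *E dG) *m x.
    rewrite [RHS]addrAC -mulmxBl -tomxN -tomxD; congr (tomx _ *m x + _).
    rewrite !(tadjD, tadjN, tadjM, hE, hG) !einE.
    by apply/ffunP => p; rewrite !entryE; ring.
  have := mfroB (tomx ((A + dA)^H - E *E (G + dG)) *m x + t *: x)
      (tomx (dA^H - E *E dG) *m x).
  have := mfroM (tomx (dA^H - E *E dG)) x; rewrite -fro_tomx.
  have : fro (dA^H - E *E dG) * mfro x <= c / 2 * mfro x.
    rewrite ler_wpM2r ?mfro_ge0 //; apply: le_trans dle' _.
    by rewrite -ler_pdivlMr //; lra.
  lra.
- rewrite -fro_tomx; have -> : A + dA - (G + dG) *E E = A - G *E E + (dA - dG *E E).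
    by rewrite !einE; apply/ffunP => p; rewrite !entryE; ring.
  apply: le_trans (froD _ _) _; have := fro_ge0 G; rewrite /m; lra.
- rewrite -fro_tomx; apply: le_trans (froD _ _) _; have := fro_ge0 (A - G *E E).
  rewrite /m; lra.
- by rewrite -!tomxE clE; apply/stableP.
rewrite -!tomxE clE -fro_tomx tadjD.
have -> : (A^H + dA^H - E *E (G + dG)) *E (X - E) +
    (X - E) *E (A + dA - (G + dG) *E X) = - ric1 E dA dG dK.
  rewrite -tadjD (riccati_diff _ _ (K + dK)) ricX sub0r; congr (- _).
  rewrite -[RHS]add0r -ric /riccati /ric1 !(tadjD) !einE.
  by apply/ffunP => p; rewrite !entryE; ring.
rewrite froN /ric1 /d; apply: le_trans (froD _ _) _.
have : fro (dA^H *E E) <= e * fro E.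
  by apply: le_trans (froM _ _) _; rewrite froH ler_wpM2r.
have : fro (E *E dA) <= fro E * e.
  by apply: le_trans (froM _ _) _; rewrite ler_wpM2l.
have : fro (E *E dG *E E) <= fro E * e * fro E.
  apply: le_trans (froM _ _) _; rewrite ler_wpM2r //.
  by apply: le_trans (froM _ _) _; rewrite ler_wpM2l.
have := froB (dA^H *E E + E *E dA) (E *E dG *E E).
have := froD (dA^H *E E) (E *E dA); lra.
Qed.

End RiccatiPerturbation.

(** * Right limits at 0 of almost nonincreasing functions *)

Section LimitAtZero.
Variable R : realType.
Local Open Scope classical_set_scope.

(** The limit is the supremum of [g e / (1 + c * e)]: a near-maximizer [e1] bounds [g] from below on
    all of []0, e1]], and the supremum itself gives the upper bound. *)
Lemma almost_nonincreasing_limit (g : R -> R) (c e0 M : R) :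
  0 <= c -> 0 < e0 -> (forall e, 0 < e <= e0 -> 0 <= g e <= M) ->
  (forall d e, 0 < d -> d <= e -> e <= e0 -> g e <= (1 + c * e) * g d) ->
  exists k : R, [/\ g x @[x --> 0^'+] --> k,
    forall e, 0 < e <= e0 -> g e <= (1 + c * e) * k &
    forall b, (forall h, 0 < h -> exists2 e, 0 < e <= h & g e <= b) -> k <= b].
Proof.
move=> c0 e00 gM gd.
pose S := [set x | exists2 e, 0 < e <= e0 & x = g e / (1 + c * e)].
have c1 e : 0 < e <= e0 -> 0 < 1 + c * e.
  by case/andP=> ep _; rewrite ltr_wpDr // mulr_ge0 // ltW.
have supS : has_sup S.
  split; first by exists (g e0 / (1 + c * e0)), e0; rewrite // e00 lexx.
  exists M => _ [e ee0 ->]; have /andP[g0 gm] := gM e ee0; have ce := c1 e ee0.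
  rewrite ler_pdivrMr //; apply: (le_trans gm); rewrite ler_peMr ?(le_trans g0) //.
  by rewrite lerDl mulr_ge0 // ltW //; case/andP: ee0.
have up e : 0 < e <= e0 -> g e <= (1 + c * e) * sup S.
  move=> ee0; rewrite mulrC -ler_pdivrMr ?c1 //.
  by apply: (ub_le_sup supS.2); exists e.
have lo h : 0 < h -> exists2 e1, 0 < e1 <= e0 & forall e, 0 < e <= e1 -> sup S - h < g e.
  move=> h0; have [_ [e1 /andP[e10 e1e0] ->] he] := sup_adherent h0 supS.
  exists e1; first by rewrite e10.
  move=> e /andP[ep ee1]; apply: lt_le_trans he _.
  by rewrite ler_pdivrMr ?c1 ?e10 // mulrC gd.
have k0 : 0 <= sup S.
  have ee : 0 < e0 <= e0 by rewrite e00 lexx.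
  have /andP[g0 _] := gM _ ee; have := up e0 ee; have := c1 e0 ee.
  by move=> cc /(le_trans g0); rewrite pmulr_rge0.
exists (sup S); split => // [|b Hb].
  apply/cvgrPdist_lt => h h0; have [e1 /andP[e10 e1e0] He1] := lo h h0.
  have pos : 0 < c * sup S + 1 by rewrite ltr_wpDl // mulr_ge0.
  near=> e; have ep : 0 < e by near: e; exact: nbhs_right_gt.
  have ee1 : e <= e1 by near: e; exact: nbhs_right_le.
  have ceh : c * sup S * e < h.
    apply: (@le_lt_trans _ _ ((c * sup S + 1) * e)).
      by rewrite ler_wpM2r ?(ltW ep) // lerDl.
    rewrite mulrC -ltr_pdivlMr //; near: e; apply: nbhs_right_lt.
    by rewrite divr_gt0.
  have := He1 e; rewrite ep ee1 => /(_ isT); have := up e.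
  rewrite ep (le_trans ee1 e1e0) => /(_ isT) u l.
  rewrite ltr_norml; apply/andP; split; nra.
apply/ler_addgt0Pr => h h0; have [e1 e1e0 He1] := lo h h0.
have [e ee1 ge] := Hb e1 (andP e1e0).1.
have := He1 e ee1; lra.
Unshelve. all: by end_near.
Qed.

End LimitAtZero.

(** * Existence and characterization of the condition number *)

Section ConditionNumber.
Variables (R : realType) (N : nat) (I : dims N).
Local Notation T := (ptensor R I I).
Variables (A G K E : T) (Delta : T -> T -> T -> T -> T -> T -> R) (m : R).
Hypotheses (psdE : psd E) (hG : G^H = G) (ric : riccati A G K E = 0)
  (sE : stable (A - G *E E)) (E0 : E != 0) (m0 : 0 < m).
(** Two properties common to the three measures: they dominate the perturbations, and they behave
    well when a perturbation is shrunk by [t] and a correction [X] is added to its last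
    component. *)
Hypothesis Delta_ctrl : forall dA dG dK : T, [/\
  fro dA <= m * Delta A G K dA dG dK, fro dG <= m * Delta A G K dA dG dK &
  fro dK <= m * Delta A G K dA dG dK].
Hypothesis Delta_scale : forall (dA dG dK X : T) (t : R), 0 <= t ->
  Delta A G K (tscale t%:C dA) (tscale t%:C dG) (tscale t%:C dK + X) <=
  t * Delta A G K dA dG dK + m * fro X.

Definition perturbed (eps : R) (dA dG dK E' : T) :=
  Delta A G K dA dG dK <= eps /\
  stabilizing_solution (A + dA) (G + dG) (K + dK) E'.

Let hE : E^H = E := proj1 psdE.

Lemma froE_gt0 : 0 < fro E. Proof. exact: fro_gt0. Qed.

Lemma riccatiD (A' G' K' X E' : T) :
  riccati A' G' (K' + X) E' = riccati A' G' K' E' + X.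
Proof. by rewrite /riccati addrA. Qed.

(** Makes the suprema nonnegative instead of suprema of an empty set. *)
Lemma perturbed0 eps : 0 <= eps -> perturbed eps 0 0 0 E.
Proof.
move=> e0; split; last by split; rewrite ?addr0.
have := Delta_scale 0 0 0 0 (lexx 0).
by rewrite !tscale0l fro0 addr0 mulr0 mul0r addr0 => /le_trans; apply.
Qed.

Lemma psd_convex (E' : T) (t : R) : 0 <= t <= 1 -> psd E' ->
  psd (E + tscale t%:C (E' - E)).
Proof.
move=> /andP[t0 t1] [hE' pE']; split.
  by rewrite /Defs.hermitian tadjD tadjZ conjc_real tadjD tadjN hE hE'.
move=> Y p; have -> : (Y^H *E (E + tscale t%:C (E' - E)) *E Y) p =
    (1 - t)%:C * (Y^H *E E *E Y) p + t%:C * (Y^H *E E' *E Y) p.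
  by rewrite !einE !entryE rmorphB rmorph1; ring.
apply: addr_ge0; apply: mulr_ge0; rewrite ?ler0c ?subr_ge0 ?pE' //.
exact: psdE.2.
Qed.

Lemma lyapunov_perturbed eps dA dG dK E' : perturbed eps dA dG dK E' ->
  lyapunov A G E (E' - E) =
  - (ric1 E dA dG dK + (ric2 G E dA dG (E' - E) + ric3 dG (E' - E))).
Proof.
case=> _ [_ ric' _]; have := riccati_expand A K dA dG dK (E' - E) 1 hE hG.
rewrite !expr1n !tscale1 [E + _]addrC subrK ric' ric add0r.
move: (lyapunov _ _ _ _) (ric1 _ _ _ _) (ric2 _ _ _ _ _) (ric3 _ _).
by move=> l r1 r2 r3 /esym/eqP; rewrite -!addrA addr_eq0 => /eqP.
Qed.

(** Once [E' - E] is of order [eps], every term of [ric2] is of order [eps ^+ 2], and the cubic term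
    is absorbed because [eps <= 1]. *)
Lemma perturbed_bounds : exists B c e0 : R, [/\ 0 <= B, 0 <= c, 0 < e0 <= 1 &
  forall eps dA dG dK E', 0 <= eps <= e0 -> perturbed eps dA dG dK E' ->
    fro (E' - E) <= B * eps /\
    fro (ric2 G E dA dG (E' - E)) + fro (ric3 dG (E' - E)) <= c * eps ^+ 2].
Proof.
have [B [e1 [B0 e10 HB]]] := stabilizing_apriori hE hG ric sE.
pose b := B * m.
have b0 : 0 <= b by rewrite mulr_ge0 // ltW.
have fE := fro_ge0 E; have fG := fro_ge0 G.
pose c := 2 * m * b + b * fro G * b + 2 * fro E * m * b + b * m * b.
exists b, c, (Num.min 1 (e1 / m)); split=> //.
- by rewrite /c !addr_ge0 // !mulr_ge0 // ltW.
- by rewrite lt_min ltr01 divr_gt0 //= ge_min lexx.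
move=> eps dA dG dK E' /andP[eps0]; rewrite le_min => /andP[eps1 epse].
case=> De [_ ric' s']; have [Am Gm Km] := Delta_ctrl dA dG dK.
have mD : m * Delta A G K dA dG dK <= m * eps by rewrite ler_wpM2l // ltW.
have Ha := le_trans Am mD; have Hg := le_trans Gm mD; have Hk := le_trans Km mD.
have HH : fro (E' - E) <= b * eps.
  rewrite /b -mulrA; apply: HB ric' s' => //.
  by rewrite mulrC -ler_pdivlMr.
split=> //; set H := E' - E in HH *.
have H0 := fro_ge0 H; have me0 : 0 <= m * eps by rewrite mulr_ge0 // ltW.
have be0 : 0 <= b * eps by rewrite mulr_ge0.
have M2 (X Y : T) (x y : R) : fro X <= x -> fro Y <= y -> fro (X *E Y) <= x * y.
  by move=> xx yy; apply: le_trans (froM _ _) _; rewrite ler_pM ?fro_ge0.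
have t1 : fro (dA^H *E H) <= m * eps * (b * eps) by apply: M2; rewrite ?froH.
have t2 : fro (H *E dA) <= b * eps * (m * eps) by apply: M2.
have t3 : fro (H *E G *E H) <= b * eps * fro G * (b * eps).
  exact: (M2 _ _ _ _ (M2 _ _ _ _ HH (lexx _)) HH).
have t4 : fro (E *E dG *E H) <= fro E * (m * eps) * (b * eps).
  exact: (M2 _ _ _ _ (M2 _ _ _ _ (lexx _) Hg) HH).
have t5 : fro (H *E dG *E E) <= b * eps * (m * eps) * fro E.
  exact: (M2 _ _ _ _ (M2 _ _ _ _ HH Hg) (lexx _)).
have t6 : fro (H *E dG *E H) <= b * eps * (m * eps) * (b * eps).
  exact: (M2 _ _ _ _ (M2 _ _ _ _ HH Hg) HH).
have e3 : b * eps * (m * eps) * (b * eps) <= b * m * b * eps ^+ 2.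
  have -> : b * eps * (m * eps) * (b * eps) = b * m * b * eps ^+ 2 * eps by ring.
  by rewrite ler_piMr // !mulr_ge0 ?sqr_ge0 // ltW.
rewrite /ric2 /ric3 froN.
have s1 := froB (dA^H *E H + H *E dA - H *E G *E H - E *E dG *E H) (H *E dG *E E).
have s2 := froB (dA^H *E H + H *E dA - H *E G *E H) (E *E dG *E H).
have s3 := froB (dA^H *E H + H *E dA) (H *E G *E H).
have s4 := froD (dA^H *E H) (H *E dA).
have -> : c * eps ^+ 2 = m * eps * (b * eps) + b * eps * (m * eps) +
   b * eps * fro G * (b * eps) + fro E * (m * eps) * (b * eps) +
   b * eps * (m * eps) * fro E + b * m * b * eps ^+ 2 by rewrite /c; ring.
lra.
Qed.

(* Shrinking E' towards E keeps it positive semidefinite, and the residual of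
   the shrunk perturbation is of second order, so that it can be absorbed in
   dK. *)
Lemma perturbed_shrink : exists c e0 : R, [/\ 0 <= c, 0 < e0 &
  forall d eps dA dG dK E', 0 < d -> d <= eps -> eps <= e0 ->
    perturbed eps dA dG dK E' ->
    exists dA' dG' dK' E'', perturbed d dA' dG' dK' E'' /\
      fro (E'' - E) / d = fro (E' - E) / eps / (1 + c * eps)].
Proof.
have [B [c [e0 [B0 c0 /andP[e00 e01] HB]]]] := perturbed_bounds.
have [r r0 Hr] := stable_open sE.
have fE := fro_ge0 E; have fG := fro_ge0 G.
(* [(q - 1) * eps] bounds the change of the closed-loop tensor; the extra 1 makes it strictly
   smaller than the stability radius [r]. *)
pose q := m + m * fro E + fro G * B + m * B + 1.
have mE : 0 <= m * fro E by rewrite mulr_ge0 // ltW.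
have mB : 0 <= m * B by rewrite mulr_ge0 // ltW.
have GB : 0 <= fro G * B by rewrite mulr_ge0.
have q0 : 0 < q by rewrite /q; have := m0; lra.
exists (m * c), (Num.min e0 (r / q)); split.
- by rewrite mulr_ge0 // ltW.
- by rewrite lt_min e00 divr_gt0.
move=> d eps dA dG dK E' d0 de; rewrite le_min => /andP[ee0 er] pert.
have eps0 : 0 < eps := lt_le_trans d0 de.
have [|HH Q] := HB eps dA dG dK E' _ pert; first by rewrite (ltW eps0).
have lyap := lyapunov_perturbed pert.
case: pert => De [psd' ric' s'].
set H := E' - E in HH Q lyap *.
have mc0 : 0 <= m * c by rewrite mulr_ge0 // ltW.
have u1 : 1 <= 1 + m * c * eps by rewrite lerDl mulr_ge0 // ltW.
have u0 : 0 < 1 + m * c * eps by lra.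
(* Chosen so that [t * eps], from shrinking, plus [m * (t * (c * eps ^+ 2))], from the correction
   [Qt], add up to exactly [d]. *)
pose t := d / (eps * (1 + m * c * eps)).
have t0 : 0 < t by rewrite divr_gt0 // mulr_gt0.
have t1 : t <= 1.
  rewrite ler_pdivrMr ?mulr_gt0 // mul1r; apply: le_trans de _.
  by rewrite ler_peMr // ltW.
have td : t * (eps * (1 + m * c * eps)) = d.
  by rewrite /t divfK // mulf_neq0 // gt_eqF.
(* The residual at the shrunk data: the part of degree 1 equals [- (ric2 + ric3)] and is scaled by
   [t], the other two by [t ^+ 2] and [t ^+ 3]. Subtracting it from [dK] restores the equation. *)
pose Qt := tscale (t ^+ 2 - t)%:C (ric2 G E dA dG H) +
  tscale (t ^+ 3 - t)%:C (ric3 dG H).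
have Qle : fro Qt <= t * (c * eps ^+ 2).
  apply: le_trans (froD _ _) _; rewrite !froZ !normc_real.
  apply: (@le_trans _ _ (t * fro (ric2 G E dA dG H) + t * fro (ric3 dG H))).
    apply: lerD; rewrite ler_wpM2r ?fro_ge0 // ler_norml.
      by apply/andP; split; nra.
    have t3 : t ^+ 3 <= t by rewrite exprS ler_piMr ?exprn_ile1 // ltW.
    have := exprn_ge0 3 (ltW t0); lra.
  by rewrite -mulrDr ler_wpM2l // ltW.
have rict : riccati (A + tscale t%:C dA) (G + tscale t%:C dG)
    (K + tscale t%:C dK) (E + tscale t%:C H) = Qt.
  rewrite riccati_expand // ric add0r lyap /Qt.
  by apply/ffunP => p; rewrite !entryE !rmorphB /=; ring.
exists (tscale t%:C dA), (tscale t%:C dG), (tscale t%:C dK - Qt), (E + tscale t%:C H).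
split; last first.
  rewrite addrC addKr froZ normc_real ger0_norm ?(ltW t0) //.
  by rewrite /t; field; rewrite !gt_eqF.
split; last split.
- apply: le_trans (Delta_scale _ _ _ _ (ltW t0)) _; rewrite froN.
  have : t * Delta A G K dA dG dK <= t * eps by rewrite ler_wpM2l // ltW.
  have : m * fro Qt <= m * (t * (c * eps ^+ 2)) by rewrite ler_wpM2l // ltW.
  have -> : d = t * eps + m * (t * (c * eps ^+ 2)) by rewrite -td; ring.
  lra.
- by apply: psd_convex psd'; rewrite (ltW t0).
- by rewrite addrA riccatiD rict subrr.
have -> : A + tscale t%:C dA - (G + tscale t%:C dG) *E (E + tscale t%:C H) =
    A - G *E E + tscale t%:C (dA - dG *E E - G *E H - tscale t%:C (dG *E H)).
  by rewrite !einE; apply/ffunP => p; rewrite !entryE; ring.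
apply: Hr; rewrite froZ normc_real ger0_norm ?(ltW t0) //.
have [Am Gm _] := Delta_ctrl dA dG dK.
have mD : m * Delta A G K dA dG dK <= m * eps by rewrite ler_wpM2l // ltW.
have Ha := le_trans Am mD; have Hg := le_trans Gm mD.
have s1 := froB (dA - dG *E E - G *E H) (tscale t%:C (dG *E H)).
have s2 := froB (dA - dG *E E) (G *E H).
have s3 := froB dA (dG *E E).
have me0 : 0 <= m * eps by rewrite mulr_ge0 // ltW.
have g1 : fro (dG *E E) <= m * eps * fro E.
  by apply: le_trans (froM _ _) _; rewrite ler_wpM2r.
have g2 : fro (G *E H) <= fro G * (B * eps).
  by apply: le_trans (froM _ _) _; rewrite ler_wpM2l.
have g3 : fro (tscale t%:C (dG *E H)) <= m * B * eps.
  rewrite froZ normc_real ger0_norm ?(ltW t0) //.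
  apply: (@le_trans _ _ (fro (dG *E H))); first by rewrite ler_piMl ?fro_ge0.
  apply: le_trans (froM _ _) _; apply: (@le_trans _ _ (m * eps * (B * eps))).
    by rewrite ler_pM ?fro_ge0.
  have -> : m * eps * (B * eps) = m * B * eps * eps by ring.
  by rewrite ler_piMr ?(le_trans ee0) // mulr_ge0 // ltW.
have qe : q * eps <= r by rewrite mulrC -ler_pdivlMr.
set X := dA - _ - _ - _ in s1 *.
apply: (@le_lt_trans _ _ (fro X)); first by rewrite ler_piMl ?fro_ge0.
by rewrite /q in qe; lra.
Qed.

(** Replaces the limit by a real number used from both sides: [k] bounds every small perturbation up
    to a factor [1 + c * eps], and any first-order bound [b + d * eps] on the ratios passes to
    [k <= b]. *)
Lemma cond_number_spec : exists k c e0 : R, [/\ 0 <= c, 0 < e0,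
  cond_number Delta A G K E = k%:E,
  (forall eps dA dG dK E', 0 < eps <= e0 -> perturbed eps dA dG dK E' ->
    fro (E' - E) / (eps * fro E) <= (1 + c * eps) * k) &
  (forall b d e1 : R, 0 < e1 ->
    (forall eps dA dG dK E', 0 < eps <= e1 -> perturbed eps dA dG dK E' ->
       fro (E' - E) / (eps * fro E) <= b + d * eps) -> k <= b)].
Proof.
have [c [e1 [c0 e10 Hs]]] := perturbed_shrink.
have [B [c' [e2 [B0 _ /andP[e20 _] HB]]]] := perturbed_bounds.
have fE := froE_gt0.
have [e0 [e00 e01 e02]] : exists e0, [/\ 0 < e0, e0 <= e1 & e0 <= e2].
  by exists (Num.min e1 e2); rewrite lt_min e10 e20 !ge_min !lexx orbT.
pose f (eps : R) := ereal_sup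
    [set (fro (p.2 - E) / (eps * fro E))%:E | p in
      [set p : (T * T * T) * T |
        let: (dA, dG, dK, E') := p in
        Delta A G K dA dG dK <= eps /\
        stabilizing_solution (A + dA) (G + dG) (K + dK) E']]%classic.
have fge eps dA dG dK E' : perturbed eps dA dG dK E' ->
    ((fro (E' - E) / (eps * fro E))%:E <= f eps)%E.
  by move=> pert; apply: ereal_sup_ubound; exists (dA, dG, dK, E').
have fle eps (b : R) : (forall dA dG dK E', perturbed eps dA dG dK E' ->
    fro (E' - E) / (eps * fro E) <= b) -> (f eps <= b%:E)%E.
  move=> Hb; apply: ge_ereal_sup => _ [[[[dA dG] dK] E'] pert <-].
  by rewrite lee_fin; exact: Hb pert.
have fM eps : 0 < eps <= e0 -> (0 <= f eps <= (B / fro E)%:E)%E.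
  case/andP=> eps0 /le_trans/(_ e02) epse; apply/andP; split.
    apply: le_trans (fge _ _ _ _ _ (perturbed0 (ltW eps0))).
    by rewrite lee_fin divr_ge0 ?fro_ge0 ?mulr_ge0 // ltW.
  apply: fle => dA dG dK E' pert.
  have [|HH _] := HB eps dA dG dK E' _ pert; first by rewrite (ltW eps0).
  rewrite ler_pdivrMr ?mulr_gt0 //; apply: le_trans HH _.
  by rewrite mulrA mulrAC divfK ?gt_eqF.
have fK eps : 0 < eps <= e0 -> f eps = (fine (f eps))%:E.
  move=> ee; rewrite fineK // ge0_fin_numE; last by case/andP: (fM _ ee).
  by apply: le_lt_trans (ltry (B / fro E)); case/andP: (fM _ ee).
have [||k [gk kup klo]] := @almost_nonincreasing_limit R (fine \o f) c e0 (B / fro E) c0 e00.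
- by move=> e ee; rewrite -!lee_fin /= -fK //; exact: fM.
(* By shrinking, each ratio at level [e] is [1 + c * e] times a ratio at level [d]. *)
- move=> d e d0 de ee0; have ep := lt_le_trans d0 de.
  rewrite -lee_fin /= -fK ?ep //; apply: fle => dA dG dK E' pert.
  have e1e : e <= e1 := le_trans ee0 e01.
  have [dA' [dG' [dK' [E'' [pert' eqr]]]]] := Hs d e dA dG dK E' d0 de e1e pert.
  have /fge : perturbed d dA' dG' dK' E'' := pert'.
  rewrite fK ?d0 ?(le_trans de) // lee_fin => le1.
  have ce : 0 < 1 + c * e by rewrite ltr_wpDr // mulr_ge0 // ltW.
  apply: le_trans (ler_wpM2l (ltW ce) le1).
  rewrite [_ / (d * _)](_ : _ = fro (E'' - E) / d / fro E); last by rewrite invfM mulrA.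
  rewrite eqr.
  by rewrite le_eqVlt; apply/orP; left; apply/eqP; field; rewrite !gt_eqF.
exists k, c, e0; split=> //.
- apply: cvg_lim => //; apply/fine_cvgP; split=> //.
  near=> x; rewrite -/(f x) fK //; apply/andP; split.
    by near: x; exact: nbhs_right_gt.
  by near: x; exact: nbhs_right_le.
- move=> eps dA dG dK E' ee pert; apply: le_trans (kup _ ee).
  by rewrite -lee_fin /= -fK //; exact: fge pert.
move=> b d e3 e30 Hb; apply/ler_addgt0Pr => h h0; apply: klo => x x0.
have pos : 0 < `|d| + 1 by rewrite ltr_wpDl.
(* The last bound gives [d * e <= h]; the added 1 covers [d = 0]. *)
pose e := Num.min (Num.min e0 e3) (Num.min x (h / (`|d| + 1))).
have e_gt0 : 0 < e by rewrite !lt_min e00 e30 x0 divr_gt0.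
have : e <= e by [].
rewrite {2}/e !le_min => /andP[/andP[ee0 ee3] /andP[ex eh]].
exists e; first by rewrite e_gt0.
rewrite -lee_fin /= -fK ?e_gt0 //; apply: fle => dA dG dK E' pert.
apply: le_trans (Hb _ _ _ _ _ _ pert) _; first by rewrite e_gt0.
rewrite lerD2l; move: eh; rewrite ler_pdivlMr // => eh.
by have := ler_norm d; nra.
Unshelve. all: by end_near.
Qed.

End ConditionNumber.

(** * Vectorized first-order equation for the perturbed solution *)

Section FirstOrder.
Variables (R : realType) (N : nat) (I : dims N).
Local Notation T := (ptensor R I I).
Implicit Types A G K E M dA dG dK : T.

(** The tensor [Z] of the theorem: [lyapunov] read through [tvec]. *)
Definition kron_lyapunov A G E : ptensor R (dims_mul I I) (dims_mul I I) :=
  tid R I *K (A - G *E E)^H + (A - G *E E)^tr *K tid R I.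

Lemma kron_lyapunov_tvec A G E M :
  kron_lyapunov A G E *E tvec M = tvec (lyapunov A G E M).
Proof.
by rewrite /kron_lyapunov einDl !kron_tvec ttr_id ttrK ein1r ein1l -tvecD.
Qed.

(** Every vector is some [tvec], and the Lyapunov operator is injective because [A - G *E E] and its
    adjoint are stable; so [Z] is invertible. *)
Lemma tvec_lyapunovK A G E M : stable (A - G *E E) ->
  tinv (kron_lyapunov A G E) *E tvec (lyapunov A G E M) = tvec M.
Proof.
move=> sE; rewrite -kron_lyapunov_tvec einA tinvK ?ein1l // => X.
have [M' ->] := tvec_surj X; rewrite kron_lyapunov_tvec => /tvec_inj0 L0.
rewrite (sylvester_tensor_inj (stable_adj sE) sE L0).
by apply/ffunP => p; rewrite !ffunE.
Qed.

Lemma tvec_ric1 E dA dG dK : tvec (ric1 E dA dG dK) =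
  (E^tr *K tid R I) *E tvec dA^H + (tid R I *K E) *E tvec dA
  - (E^tr *K E) *E tvec dG + tvec dK.
Proof.
rewrite !kron_tvec ttr_id ttrK ein1r ein1l /ric1.
by rewrite !tvecD tvecN.
Qed.

(** Inverting [Z] splits [tvec (E' - E)] into the image of [ric1], bounded by [b * eps], and a
    remainder of order [eps ^+ 2], which vanishes in the limit. Each upper bound thus reduces to an
    inequality about [ric1]. *)
Lemma cond_number_le A G K E
    (Delta : T -> T -> T -> T -> T -> T -> R) (m b : R) :
  psd E -> G^H = G -> riccati A G K E = 0 -> stable (A - G *E E) -> E != 0 ->
  0 < m ->
  (forall dA dG dK : T, [/\
    fro dA <= m * Delta A G K dA dG dK, fro dG <= m * Delta A G K dA dG dK &
    fro dK <= m * Delta A G K dA dG dK]) ->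
  (forall (dA dG dK X : T) (t : R), 0 <= t ->
    Delta A G K (tscale t%:C dA) (tscale t%:C dG) (tscale t%:C dK + X) <=
    t * Delta A G K dA dG dK + m * fro X) ->
  0 <= b ->
  (forall dA dG dK,
    fro (tinv (kron_lyapunov A G E) *E tvec (ric1 E dA dG dK)) <=
    b * Delta A G K dA dG dK) ->
  (cond_number Delta A G K E <= (b / fro E)%:E)%E.
Proof.
move=> pE hG ric sE E0 m0 ctrl scl b0 Hb.
have [k [_ [_ [_ _ -> _ kmin]]]] := cond_number_spec pE hG ric sE E0 m0 ctrl scl.
have [B [c [e0 [_ c0 /andP[e00 _] HB]]]] := perturbed_bounds pE hG ric sE m0 ctrl.
have fE := fro_gt0 E0; rewrite lee_fin.
set Z := kron_lyapunov A G E in Hb.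
apply: (kmin _ (spectral_norm (tinv Z) * c / fro E) _ e00).
move=> eps dA dG dK E' /andP[eps0 epse] pert.
have [|_ Q] := HB eps dA dG dK E' _ pert; first by rewrite (ltW eps0).
have HE : tvec (E' - E) = - (tinv Z *E tvec (ric1 E dA dG dK)) -
    tinv Z *E tvec (ric2 G E dA dG (E' - E) + ric3 dG (E' - E)).
  rewrite -(tvec_lyapunovK (E' - E) sE) -/Z (lyapunov_perturbed pE hG ric pert).
  by rewrite tvecN einNr tvecD einDr opprD.
rewrite ler_pdivrMr ?mulr_gt0 // -fro_tvec HE.
apply: le_trans (froB _ _) _; rewrite froN.
have -> : (b / fro E + spectral_norm (tinv Z) * c / fro E * eps) * (eps * fro E) =
    b * eps + spectral_norm (tinv Z) * (c * eps ^+ 2).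
  by field; rewrite gt_eqF.
apply: lerD.
  by apply: le_trans (Hb _ _ _) _; rewrite ler_wpM2l //; case: pert.
apply: le_trans (fro_ein_le _ _) _; rewrite ler_wpM2l ?sqrtr_ge0 // fro_tvec.
exact: le_trans (froD _ _) Q.
Qed.

End FirstOrder.

(** * The three measures of perturbation *)

Section Deltas.
Variables (R : realType) (N : nat) (I : dims N).
Local Notation T := (ptensor R I I).
Implicit Types A G K E dA dG dK X : T.

Definition norm3 (a b c : R) : R := Num.sqrt (a ^+ 2 + b ^+ 2 + c ^+ 2).

Lemma sum3_ge0 (a b c : R) : 0 <= a ^+ 2 + b ^+ 2 + c ^+ 2.
Proof. by rewrite !addr_ge0 ?sqr_ge0. Qed.

Lemma norm3_ge (a b c : R) : 0 <= a -> 0 <= b -> 0 <= c ->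
  [/\ a <= norm3 a b c, b <= norm3 a b c & c <= norm3 a b c].
Proof.
move=> a0 b0 c0; have := sqr_ge0 a; have := sqr_ge0 b; have := sqr_ge0 c.
by split; rewrite -(@ler_pXn2r _ 2) ?nnegrE ?sqrtr_ge0 // sqr_sqrtr ?sum3_ge0 //; lra.
Qed.

(** Only the third component exceeds its scaling; after squaring, its cross term [2 t y c] is at
    most [2 t y] times the norm. *)
Lemma norm3_scaleD (t a b c a' b' c' y : R) : 0 <= t -> 0 <= a -> 0 <= b ->
  0 <= c -> 0 <= c' -> 0 <= y -> a' = t * a -> b' = t * b -> c' <= t * c + y ->
  norm3 a' b' c' <= t * norm3 a b c + y.
Proof.
move=> t0 a0 b0 c0 c'0 y0 -> -> cc.
have s0 : 0 <= norm3 a b c := sqrtr_ge0 _.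
have [_ _ cs] := norm3_ge a0 b0 c0.
rewrite -(@ler_pXn2r _ 2) ?nnegrE ?sqrtr_ge0 ?addr_ge0 ?mulr_ge0 //.
rewrite sqr_sqrtr ?sum3_ge0 // sqrrD [(t * norm3 _ _ _) ^+ 2]exprMn sqr_sqrtr ?sum3_ge0 //.
have c2 : c' ^+ 2 <= (t * c + y) ^+ 2.
  by rewrite lerXn2r ?nnegrE ?addr_ge0 ?mulr_ge0.
have ty : 0 <= t * y by rewrite mulr_ge0.
have : t * y * c <= t * y * norm3 a b c by rewrite ler_wpM2l.
lra.
Qed.

Lemma fro_rowblock3 dA dG dK :
  fro (rowblock [:: dA; dG; dK]) = norm3 (fro dA) (fro dG) (fro dK).
Proof.
rewrite -[LHS]ger0_norm ?fro_ge0 // -sqrtr_sqr fro_rowblock.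
by rewrite !big_ord_recl big_ord0 /= addr0 addrA.
Qed.

Lemma fro_tscale_real (t : R) X : 0 <= t -> fro (tscale t%:C X) = t * fro X.
Proof. by move=> t0; rewrite froZ normc_real ger0_norm. Qed.

Variables A G K : T.
Hypothesis K0 : K != 0.
Let K_gt0 : 0 < fro K := fro_gt0 K0.

(** One constant for both requirements: the first three terms serve the control of [dA], [dG] and
    [dK], the last one the correction added to [dK]. *)
Definition delta12_bound := fro A + fro G + fro K + (fro K)^-1.

Lemma delta12_bound_gt0 : 0 < delta12_bound.
Proof.
have := fro_ge0 A; have := fro_ge0 G; have := K_gt0; rewrite /delta12_bound.
have : 0 < (fro K)^-1 by rewrite invr_gt0.
lra.
Qed.

Lemma delta12_bound_ge (x D : R) X : 0 < fro X -> fro X <= delta12_bound ->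
  x / fro X <= D -> 0 <= D -> x <= delta12_bound * D.
Proof.
move=> X0 Xb; rewrite ler_pdivrMr // mulrC => xD D0; apply: le_trans xD _.
by rewrite ler_wpM2r.
Qed.

Lemma delta12_bounds : [/\ fro A <= delta12_bound, fro G <= delta12_bound,
  fro K <= delta12_bound & (fro K)^-1 <= delta12_bound].
Proof.
have := fro_ge0 A; have := fro_ge0 G; have := K_gt0; rewrite /delta12_bound.
have : 0 < (fro K)^-1 by rewrite invr_gt0.
by split; lra.
Qed.

Lemma fro_tscaleD_div (t : R) dK X : 0 <= t ->
  fro (tscale t%:C dK + X) / fro K <= t * (fro dK / fro K) + delta12_bound * fro X.
Proof.
move=> t0; have [_ _ _ Kb] := delta12_bounds.
apply: (@le_trans _ _ (t * (fro dK / fro K) + (fro K)^-1 * fro X)).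
  rewrite mulrA [_^-1 * _]mulrC -mulrDl ler_wpM2r ?invr_ge0 ?(ltW K_gt0) //.
  by rewrite -fro_tscale_real // froD.
by rewrite lerD2l ler_wpM2r ?fro_ge0.
Qed.

Let ratio_ge0 (X Y : T) : 0 <= fro X / fro Y.
Proof. by rewrite divr_ge0 ?fro_ge0. Qed.

Section Delta12.
Hypotheses (A0 : A != 0) (G0 : G != 0).
Let A_gt0 : 0 < fro A := fro_gt0 A0.
Let G_gt0 : 0 < fro G := fro_gt0 G0.

Lemma Delta1_ctrl dA dG dK : [/\
  fro dA <= delta12_bound * Delta1 A G K dA dG dK,
  fro dG <= delta12_bound * Delta1 A G K dA dG dK &
  fro dK <= delta12_bound * Delta1 A G K dA dG dK].
Proof.
have [bA bG bK _] := delta12_bounds.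
have [hA hG hK] := norm3_ge (ratio_ge0 dA A) (ratio_ge0 dG G) (ratio_ge0 dK K).
by split; [apply: delta12_bound_ge bA hA _|apply: delta12_bound_ge bG hG _|
  apply: delta12_bound_ge bK hK _] => //; exact: sqrtr_ge0.
Qed.

Lemma Delta1_scale dA dG dK X (t : R) : 0 <= t ->
  Delta1 A G K (tscale t%:C dA) (tscale t%:C dG) (tscale t%:C dK + X) <=
  t * Delta1 A G K dA dG dK + delta12_bound * fro X.
Proof.
move=> t0; apply: norm3_scaleD => //; rewrite ?fro_tscale_real ?mulrA //.
- by rewrite mulr_ge0 ?fro_ge0 // ltW // delta12_bound_gt0.
- by rewrite -mulrA fro_tscaleD_div.
Qed.

Lemma Delta2_ge dA dG dK : [/\
  fro dA / fro A <= Delta2 A G K dA dG dK,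
  fro dG / fro G <= Delta2 A G K dA dG dK,
  fro dK / fro K <= Delta2 A G K dA dG dK & 0 <= Delta2 A G K dA dG dK].
Proof. by rewrite /Delta2; split; rewrite !le_max ?lexx ?orbT ?ratio_ge0. Qed.

Lemma Delta2_ctrl dA dG dK : [/\
  fro dA <= delta12_bound * Delta2 A G K dA dG dK,
  fro dG <= delta12_bound * Delta2 A G K dA dG dK &
  fro dK <= delta12_bound * Delta2 A G K dA dG dK].
Proof.
have [bA bG bK _] := delta12_bounds.
have [hA hG hK D0] := Delta2_ge dA dG dK.
by split; [apply: delta12_bound_ge bA hA _|apply: delta12_bound_ge bG hG _|
  apply: delta12_bound_ge bK hK _].
Qed.

Lemma Delta2_scale dA dG dK X (t : R) : 0 <= t ->
  Delta2 A G K (tscale t%:C dA) (tscale t%:C dG) (tscale t%:C dK + X) <=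
  t * Delta2 A G K dA dG dK + delta12_bound * fro X.
Proof.
move=> t0; have [hA hG hK D0] := Delta2_ge dA dG dK.
have X0 : 0 <= delta12_bound * fro X.
  by rewrite mulr_ge0 ?fro_ge0 // ltW // delta12_bound_gt0.
rewrite {1}/Delta2 !ge_max !fro_tscale_real // -!mulrA; apply/andP; split.
  apply/andP; split.
    by apply: (le_trans (ler_wpM2l t0 hA)); rewrite lerDl.
  by apply: (le_trans (ler_wpM2l t0 hG)); rewrite lerDl.
apply: le_trans (fro_tscaleD_div _ _ t0) _.
by rewrite lerD2r ler_wpM2l.
Qed.

Lemma Delta1_le_Delta2 dA dG dK :
  Delta1 A G K dA dG dK <= Num.sqrt 3 * Delta2 A G K dA dG dK.
Proof.
have [hA hG hK D0] := Delta2_ge dA dG dK.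
have r3 : 0 <= 3 :> R by [].
rewrite -(@ler_pXn2r _ 2) ?nnegrE ?mulr_ge0 ?sqrtr_ge0 // exprMn !sqr_sqrtr ?sum3_ge0 //.
have sq x : 0 <= x -> x <= Delta2 A G K dA dG dK -> x ^+ 2 <= Delta2 A G K dA dG dK ^+ 2.
  by move=> x0 xD; rewrite lerXn2r ?nnegrE.
have := sq _ (ratio_ge0 dA A) hA; have := sq _ (ratio_ge0 dG G) hG.
have := sq _ (ratio_ge0 dK K) hK; lra.
Qed.

End Delta12.

Let r3 : R := norm3 (fro A) (fro G) (fro K).

Lemma r3_gt0 : 0 < r3.
Proof.
have [_ _ Kr] := norm3_ge (fro_ge0 A) (fro_ge0 G) (fro_ge0 K).
exact: lt_le_trans Kr.
Qed.

Lemma Delta3E dA dG dK :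
  Delta3 A G K dA dG dK = norm3 (fro dA) (fro dG) (fro dK) / r3.
Proof. by rewrite /Delta3 !fro_rowblock3. Qed.

(** Here [r3] alone suffices; the summand [r3^-1] serves [Delta3_scale], which has to share the
    constant. *)
Lemma Delta3_ctrl dA dG dK : [/\
  fro dA <= (r3 + r3^-1) * Delta3 A G K dA dG dK,
  fro dG <= (r3 + r3^-1) * Delta3 A G K dA dG dK &
  fro dK <= (r3 + r3^-1) * Delta3 A G K dA dG dK].
Proof.
have rp := r3_gt0; have nE : r3 * Delta3 A G K dA dG dK = norm3 (fro dA) (fro dG) (fro dK).
  by rewrite Delta3E mulrC divfK ?gt_eqF.
have : 0 <= r3^-1 * Delta3 A G K dA dG dK.
  by rewrite Delta3E !mulr_ge0 ?invr_ge0 ?sqrtr_ge0 // ltW.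
have [hA hG hK] := norm3_ge (fro_ge0 dA) (fro_ge0 dG) (fro_ge0 dK).
by rewrite mulrDl nE; split; lra.
Qed.

Lemma Delta3_scale dA dG dK X (t : R) : 0 <= t ->
  Delta3 A G K (tscale t%:C dA) (tscale t%:C dG) (tscale t%:C dK + X) <=
  t * Delta3 A G K dA dG dK + (r3 + r3^-1) * fro X.
Proof.
move=> t0; have rp := r3_gt0; rewrite !Delta3E ler_pdivrMr // mulrDl.
have -> : t * (norm3 (fro dA) (fro dG) (fro dK) / r3) * r3 =
  t * norm3 (fro dA) (fro dG) (fro dK) by rewrite -mulrA divfK ?gt_eqF.
apply: (@le_trans _ _ (t * norm3 (fro dA) (fro dG) (fro dK) + fro X)).
  apply: norm3_scaleD; rewrite ?fro_ge0 ?fro_tscale_real //.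
  by rewrite -(fro_tscale_real _ t0) froD.
rewrite lerD2l mulrAC mulrDl mulVf ?gt_eqF // mulrDl mul1r lerDr.
by rewrite !mulr_ge0 ?fro_ge0 // ltW.
Qed.

End Deltas.

(** * Bounds on the first-order term *)

Section FirstOrderBounds.
Variables (R : realType) (N : nat) (I : dims N).
Local Notation T := (ptensor R I I).
Local Notation V := (vtensor R (dims_mul I I)).
Local Notation W := (ptensor R (dims_mul I I) (dims_mul I I)).
Variables (A G K E : T) (Z' : W).

Lemma fro_stack4 (c1 c2 c3 c4 : R) (X1 X2 X3 X4 : V) :
  fro (tstack (fun b : 'I_4 => nth 0 [:: tscale c1%:C X1; tscale c2%:C X2;
    tscale c3%:C X3; tscale c4%:C X4] b)) =
  Num.sqrt (c1 ^+ 2 * fro X1 ^+ 2 + c2 ^+ 2 * fro X2 ^+ 2 +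
    c3 ^+ 2 * fro X3 ^+ 2 + c4 ^+ 2 * fro X4 ^+ 2).
Proof.
rewrite -[LHS]ger0_norm ?fro_ge0 // -sqrtr_sqr fro_tstack.
rewrite !big_ord_recl big_ord0 /= !froZ !normc_real !exprMn !real_normK ?num_real //.
by rewrite addr0 !addrA.
Qed.

Lemma rowblock4_stack (M1 M2 M3 M4 : W) (X1 X2 X3 X4 : V) :
  rowblock [:: M1; M2; M3; M4] *E
    tstack (fun b : 'I_4 => nth 0 [:: X1; X2; X3; X4] b) =
  M1 *E X1 + M2 *E X2 + M3 *E X3 + M4 *E X4.
Proof.
by rewrite (rowblock_tstack (Xs := [:: _; _; _; _])) !big_ord_recl big_ord0 /=
  addr0 !addrA.
Qed.

Lemma tscale_cancel (c d : R) (M : W) (X : V) : d * c = 1 ->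
  tscale c%:C M *E tscale d%:C X = M *E X.
Proof.
by move=> dc; rewrite einZl einZr tscaleA -rmorphM mulrC dc tscale1.
Qed.

(** [ric1] is vectorized as [S1] times a stack [w] whose blocks are divided by the weights of [S1].
    As [dA^H] and [dA] have equal norms, the condition on [alpha] and [beta] merges their blocks,
    and [w] has norm exactly [Delta1]. *)
Lemma first_order_S1 (alpha beta : R) (dA dG dK : T) :
  alpha != 0 -> beta != 0 -> 1 / alpha ^+ 2 + 1 / beta ^+ 2 = 1 ->
  A != 0 -> G != 0 -> K != 0 ->
  fro (Z' *E tvec (ric1 E dA dG dK)) <=
  spectral_norm (Z' *E S1 alpha beta A G K E) * Delta1 A G K dA dG dK.
Proof.
move=> a0 b0 ab A0 G0 K0.
have fA : fro A != 0 by rewrite gt_eqF ?fro_gt0.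
have fG : fro G != 0 by rewrite gt_eqF ?fro_gt0.
have fK : fro K != 0 by rewrite gt_eqF ?fro_gt0.
pose w := tstack (fun b : 'I_4 => nth 0 [::
  tscale ((alpha * fro A)^-1)%:C (tvec dA^H);
  tscale ((beta * fro A)^-1)%:C (tvec dA);
  tscale ((fro G)^-1)%:C (tvec (- dG)); tscale ((fro K)^-1)%:C (tvec dK)] b).
have -> : tvec (ric1 E dA dG dK) = S1 alpha beta A G K E *E w.
  rewrite rowblock4_stack !tscale_cancel ?mulVf ?mulf_neq0 //.
  by rewrite tvec_ric1 tvecN einNr ein1l.
have -> : Delta1 A G K dA dG dK = fro w.
  rewrite fro_stack4 !fro_tvec froH froN; congr Num.sqrt.
  rewrite -[(fro dA / fro A) ^+ 2]mul1r -ab.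
  by field; rewrite a0 b0 fA fG fK.
by rewrite einA fro_ein_le.
Qed.

Lemma first_order_S2 (alpha beta : R) (dA dG dK : T) :
  alpha != 0 -> beta != 0 -> 1 / alpha ^+ 2 + 1 / beta ^+ 2 = 1 ->
  fro (Z' *E tvec (ric1 E dA dG dK)) <=
  spectral_norm (Z' *E S2 alpha beta E) * norm3 (fro dA) (fro dG) (fro dK).
Proof.
move=> a0 b0 ab.
pose w := tstack (fun b : 'I_4 => nth 0 [:: tscale (alpha^-1)%:C (tvec dA^H);
  tscale (beta^-1)%:C (tvec dA); tscale (1 : R)%:C (tvec (- dG));
  tscale (1 : R)%:C (tvec dK)] b).
have -> : tvec (ric1 E dA dG dK) = S2 alpha beta E *E w.
  rewrite rowblock4_stack !tscale_cancel ?mulVf // !tscale1.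
  by rewrite tvec_ric1 tvecN einNr ein1l.
have -> : norm3 (fro dA) (fro dG) (fro dK) = fro w.
  rewrite fro_stack4 !fro_tvec froH froN; congr Num.sqrt.
  rewrite !expr1n !mul1r -[fro dA ^+ 2 in LHS]mul1r -ab.
  by field; rewrite a0 b0.
by rewrite einA fro_ein_le.
Qed.

(** The four terms of [ric1] are bounded separately, by the triangle inequality; those in [dA] and
    [dA^H] share the factor [fro A]. *)
Lemma first_order_eta (dA dG dK : T) D :
  fro dA <= fro A * D -> fro dG <= fro G * D -> fro dK <= fro K * D ->
  fro (Z' *E tvec (ric1 E dA dG dK)) <=
  ((spectral_norm (Z' *E (tid R I *K E))
    + spectral_norm (Z' *E (E^tr *K tid R I))) * fro A
   + spectral_norm (Z' *E (E^tr *K E)) * fro G + spectral_norm Z' * fro K) * D.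
Proof.
move=> hA hG hK; rewrite tvec_ric1 !einE.
have le_ein (M : W) (X : T) x : fro X <= x ->
    fro (M *E tvec X) <= spectral_norm M * x.
  move=> Xx; apply: le_trans (fro_ein_le _ _) _.
  by rewrite fro_tvec ler_wpM2l ?sqrtr_ge0.
have hAH : fro dA^H <= fro A * D by rewrite froH.
have := le_ein (Z' *E (tid R I *K E)) _ _ hA.
have := le_ein (Z' *E (E^tr *K tid R I)) _ _ hAH.
have := le_ein (Z' *E (E^tr *K E)) _ _ hG.
have := le_ein Z' _ _ hK.
set t1 := Z' *E (E^tr *K tid R I) *E _; set t2 := Z' *E (tid R I *K E) *E _.
set t3 := Z' *E (E^tr *K E) *E _; set t4 := Z' *E tvec dK.
have := froD (t1 + t2 - t3) t4; have := froB (t1 + t2) t3; have := froD t1 t2.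
lra.
Qed.

End FirstOrderBounds.

(** * The bounds on the three condition numbers *)

Theorem theorem4p13 (R : realType) (N : nat) (I J L : dims N)
    (A : ptensor R I I) (B : ptensor R I J) (C : ptensor R L I)
    (G K E : ptensor R I I) (Z : ptensor R (dims_mul I I) (dims_mul I I))
    (alpha beta : R) :
  stabilizable A B ->
  detectable C A ->
  G = B *E B^H ->
  K = C^H *E C ->
  psd E ->
  riccati A G K E = 0 ->
  Z = tid R I *K (A - G *E E)^H + (A - G *E E)^tr *K tid R I ->
  alpha != 0 ->
  beta != 0 ->
  1 / alpha ^+ 2 + 1 / beta ^+ 2 = 1 ->
  (* the quotients defining the condition numbers make sense; K != 0 follows *)
  E != 0 ->
  (A != 0 -> G != 0 ->
     (cond_number (@Delta1 R N I) A G K E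
      <= (spectral_norm (tinv Z *E S1 alpha beta A G K E) / fro E)%:E)%E
     /\
     (cond_number (@Delta2 R N I) A G K E
      <= Order.min ((Num.sqrt 3)%:E * cond_number (@Delta1 R N I) A G K E)
                   (eta_c Z A G K E / fro E)%:E)%E)
  /\
  (cond_number (@Delta3 R N I) A G K E
   <= (spectral_norm (tinv Z *E S2 alpha beta E)
       * Num.sqrt (fro A ^+ 2 + fro G ^+ 2 + fro K ^+ 2) / fro E)%:E)%E.
Proof.
move=> _ det GE KE pE ric ZE a0 b0 ab E0.
have hG : G^H = G by rewrite GE tadjM tadjK.
have sE : stable (A - G *E E).
  by rewrite GE; apply: closed_loop_stable det pE _; rewrite -GE -KE.
(* If [K = 0], then 0 is a positive semidefinite solution, stabilizing by detectability, so
   uniqueness would give [E = 0]. *)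
have K0 : K != 0.
  apply: contra E0 => /eqP K0; apply/eqP.
  have ric0 : riccati A G K 0 = 0.
    by rewrite /riccati K0 !ein0r !ein0l subr0 !addr0.
  have p0 : psd (0 : ptensor R I I).
    split; first by apply/ffunP => p; rewrite !ffunE conjc0.
    by move=> Y p; rewrite ein0r ein0l tzeroE.
  have s0 : stable (A - G *E 0).
    by rewrite GE; apply: closed_loop_stable det p0 _; rewrite -GE -KE.
  exact: stabilizing_unique p0.1 hG ric0 ric s0 sE.
have fE := fro_gt0 E0.
split=> [A0 G0|]; last first.
  have := @cond_number_le _ _ _ A G K E (@Delta3 R N I) _
    (spectral_norm (tinv Z *E S2 alpha beta E) * norm3 (fro A) (fro G) (fro K))
    pE hG ric sE E0 _ (Delta3_ctrl A G K0) (Delta3_scale A G K0).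
  have r3 := r3_gt0 A G K0; apply.
  - by rewrite addr_gt0 ?invr_gt0.
  - by rewrite mulr_ge0 ?sqrtr_ge0.
  move=> dA dG dK; rewrite Delta3E -mulrA [norm3 (fro A) _ _ * _]mulrC divfK ?gt_eqF //.
  by rewrite /kron_lyapunov -ZE; exact: first_order_S2.
have m0 := delta12_bound_gt0 A G K0.
split.
  apply: (cond_number_le pE hG ric sE E0 m0 (Delta1_ctrl K0 A0 G0)
    (Delta1_scale _ _ K0)); first exact: sqrtr_ge0.
  by move=> dA dG dK; rewrite /kron_lyapunov -ZE; exact: first_order_S1.
rewrite le_min; apply/andP; split; last first.
  apply: (cond_number_le pE hG ric sE E0 m0 (Delta2_ctrl K0 A0 G0)
    (Delta2_scale _ _ K0)).
    by rewrite !addr_ge0 // mulr_ge0 ?addr_ge0 ?sqrtr_ge0.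
  move=> dA dG dK; rewrite /kron_lyapunov -ZE.
  have [hA hG' hK _] := Delta2_ge A G K dA dG dK.
  by apply: first_order_eta; rewrite mulrC -ler_pdivrMr ?fro_gt0.
have [k1 [c1 [e1 [c10 e10 -> k1up _]]]] :=
  cond_number_spec pE hG ric sE E0 m0 (Delta1_ctrl K0 A0 G0) (Delta1_scale _ _ K0).
have [k2 [_ [_ [_ _ -> _ k2min]]]] :=
  cond_number_spec pE hG ric sE E0 m0 (Delta2_ctrl K0 A0 G0) (Delta2_scale _ _ K0).
have s3 : 0 < Num.sqrt 3 :> R by rewrite sqrtr_gt0.
(* A perturbation with [Delta2] at most [eps] has [Delta1] at most [sqrt 3 * eps]. The bound for
   [Delta1] at that level, times [sqrt 3], is [sqrt 3 * k1 + 3 * c1 * k1 * eps]. *)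
rewrite -EFinM lee_fin; apply: (k2min _ (3 * c1 * k1) (e1 / Num.sqrt 3)).
  by rewrite divr_gt0.
move=> eps dA dG dK E' /andP[eps0 epse] [D2 sol].
have pert : perturbed A G K (@Delta1 R N I) (Num.sqrt 3 * eps) dA dG dK E'.
  split=> //; apply: le_trans (Delta1_le_Delta2 _ _ _ _ _ _) _.
  by rewrite ler_wpM2l // ltW.
have ee : 0 < Num.sqrt 3 * eps <= e1.
  by rewrite mulr_gt0 //= mulrC -ler_pdivlMr.
have le1 := k1up _ _ _ _ _ ee pert.
have -> : Num.sqrt 3 * k1 + 3 * c1 * k1 * eps =
    Num.sqrt 3 * ((1 + c1 * (Num.sqrt 3 * eps)) * k1).
  have s33 : Num.sqrt 3 * Num.sqrt 3 = 3 :> R by rewrite -expr2 sqr_sqrtr.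
  by rewrite -[X in X * c1]s33; ring.
have -> : fro (E' - E) / (eps * fro E) =
    Num.sqrt 3 * (fro (E' - E) / (Num.sqrt 3 * eps * fro E)).
  by field; rewrite !gt_eqF.
by rewrite ler_wpM2l // ltW.
Qed.
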